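(* Let $R>0$ be a computable real and consider the pursuit and evasion game in the closed disk $D=\{z\in\mathbb R^2:|z|\le R\}$, in which both players move with speed at most $1$. There exists a computable non-deterministic piecewise-blind winning strategy for Evader that works for any given initial position (i.e. for any initial positions $p_0\ne e_0$ in $D$ of Pursuer and Evader).
   Context: The game: Pursuer and Evader move inside $D$ with velocity of norm at most $1$, starting at distinct points $p_0$ (Pursuer) and $e_0$ (Evader) of $D$. Pursuer wants to catch Evader exactly in finite time. Evader wins a play if Pursuer's position and Evader's position differ at all times. Piecewise-blind strategy: Evader's play proceeds in steps $i=0,1,2,\dots$. At the start of step $i$, with Pursuer at $p_i$ and Evader at $e_i$, Evader selects a direction (velocity) $v_i\in\mathbb R^2$ with $|v_i|\le1$ and a time delay $\Delta_i>0$, and then moves with constant velocity $v_i$ for time $\Delta_i$ irrespective of what Pursuer does meanwhile, arriving at $e_{i+1}=e_i+\Delta_i v_i$; Evader must stay in $D$. Then Evader observes Pursuer's new position $p_{i+1}$ and the process continues. Non-deterministic computable: the selection of $(v_i,\Delta_i)$ is made by a computable multivalued function $F$ of $(i,p_i,e_i)$; that is, $F(i,p_i,e_i)$ is a set of admissible pairs, and there is an oracle Turing machine which, given $i$ and any representations of $p_i$ and $e_i$, outputs a representation of some element of $F(i,p_i,e_i)$ (which element may depend on the representations given). A function $\phi:\mathbb N\to\mathbb Q^m$ represents $z\in\mathbb R^m$ if $|z-\phi(k)|\le2^{-k}$ for all $k$. Such a strategy is winning if every play consistent with it is won by Evader: for every motion of Pursuer in $D$ with speed at most $1$ and every sequence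 of selections $(v_i,\Delta_i)\in F(i,p_i,e_i)$, the positions of Evader and Pursuer never coincide at any time, and $\sum_{i\in\mathbb N}\Delta_i=\infty$ (so that the play is defined for all times). *)

(* Defs.v *)
From mathcomp Require Import all_boot all_order all_algebra.
From mathcomp Require Import all_classical all_reals all_analysis.

Set Implicit Arguments.
Unset Strict Implicit.
Unset Printing Implicit Defensive.

Import Order.TTheory GRing.Theory Num.Theory.
Import numFieldNormedType.Exports.

Local Open Scope classical_set_scope.
Local Open Scope ring_scope.

(** * Oracle Turing machines

  Deterministic multitape machines on two-way infinite tapes over the symbols
  [None] (blank), [Some false] and [Some true]. *)

Definition word := seq bool.
Definition symbol := option bool.

(* [tleft] lists the cells left of the head, nearest first; all the cells
   beyond the two lists are blank. *)
Record tape := Tape { tleft : seq symbol; thead : symbol; tright : seq symbol }.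

Definition blank_tape : tape := Tape [::] None [::].

Definition word_tape (w : word) : tape :=
  if w is b :: w' then Tape [::] (Some b) (map Some w') else blank_tape.

Fixpoint word_prefix (s : seq symbol) : word :=
  if s is Some b :: s' then b :: word_prefix s' else [::].

(* The word that starts under the head and ends before the first blank. *)
Definition tape_word (t : tape) : word := word_prefix (thead t :: tright t).

Inductive dir := MoveLeft | MoveRight | Stay.

Definition tape_write (a : symbol) (t : tape) : tape :=
  Tape (tleft t) a (tright t).

Definition tape_move (d : dir) (t : tape) : tape :=
  match d with
  | MoveLeft => Tape (behead (tleft t)) (head None (tleft t))
                     (thead t :: tright t)
  | MoveRight => Tape (thead t :: tleft t) (head None (tright t))
                      (behead (tright t))
  | Stay => t
  end.

(* What a machine does in a given state when it reads given symbols: halt,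
   query an oracle and go to the given state, or go to the given state after
   writing a symbol and moving the head on every tape. *)
Inductive instr (I state tapes : finType) :=
  | Halt
  | Query of I & state
  | Act of state & {ffun tapes -> symbol * dir}.
Arguments Halt {I state tapes}.

(* [I] indexes the oracles. *)
Record otm (I : finType) := OTM {
  otm_state : finType;
  otm_tapes : finType;
  otm_start : otm_state;
  otm_in : otm_tapes;
  otm_query : otm_tapes;
  otm_answer : otm_tapes;
  otm_out : otm_tapes;
  otm_tapes_uniq : uniq [:: otm_in; otm_query; otm_answer; otm_out];
  otm_prog : otm_state -> {ffun otm_tapes -> symbol} ->
             instr I otm_state otm_tapes
}.

Section Run.
Variables (I : finType) (M : otm I) (O : I -> nat -> word).

Record config := Config {
  cstate : otm_state M;
  ctape : otm_tapes M -> tape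
}.

(* A query puts the answer on the answer tape. The question, a natural number,
   is read in unary on the query tape, which is left unchanged. *)
Definition otm_step (c : config) : option config :=
  match otm_prog (cstate c) [ffun x => thead (ctape c x)] with
  | Halt => None
  | Query j q => Some (Config q (fun x =>
      if x == otm_answer M
      then word_tape (O j (size (tape_word (ctape c (otm_query M)))))
      else ctape c x))
  | Act q a => Some (Config q (fun x =>
      tape_move (a x).2 (tape_write (a x).1 (ctape c x))))
  end.

Definition otm_init (w : word) : config :=
  Config (otm_start M)
    (fun x => if x == otm_in M then word_tape w else blank_tape).

Definition otm_outputs (w w' : word) : Prop :=
  exists (n : nat) (c : config),
    [/\ iter n (obind otm_step) (Some (otm_init w)) = Some c,
        otm_step c = None & tape_word (ctape c (otm_out M)) = w'].

End Run.

(** * Computability on the reals *)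

(* Numerals are unary, which is harmless since only computability matters. *)
Definition code_nat (n : nat) : word := rcons (nseq n true) false.

Definition code_nats (s : seq nat) : word := flatten (map code_nat s).

(* Sign, numerator and denominator of the fraction in lowest terms. *)
Definition code_rat (q : rat) : word :=
  (numq q < 0) :: code_nats [:: `|numq q|%N; `|denq q|%N].

Definition code_vec (m : nat) (x : 'rV[rat]_m) : word :=
  flatten [seq code_rat (x 0 j) | j <- enum 'I_m].

(* The Euclidean norm; the library norm on row vectors is the sup norm. *)
Definition enorm (K : realType) (m : nat) (x : 'rV[K]_m) : K :=
  Num.sqrt (\sum_(j < m) x 0 j ^+ 2).

Definition represents (K : realType) (m : nat)
    (phi : nat -> 'rV[rat]_m) (z : 'rV[K]_m) : Prop :=
  forall k : nat, enorm (z - map_mx ratr (phi k)) <= 2^-1 ^+ k.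

Definition vec_oracle (m : nat) (phi : nat -> 'rV[rat]_m) : nat -> word :=
  fun k => code_vec (phi k).

Definition no_oracle : void -> nat -> word := fun j => match j with end.

Definition computable_real (K : realType) (x : K) : Prop :=
  exists (M : otm void) (phi : nat -> 'rV[rat]_1),
    represents phi (const_mx x) /\
    forall k : nat, otm_outputs M no_oracle (code_nats [:: k]) (code_vec (phi k)).

(** * The game *)

Section Game.
Variables (K : realType) (r : K).

Definition disk : set 'rV[K]_2 := [set z | enorm z <= r].

(* [F i p e] is the set of the pairs (velocity, delay) that Evader may select
   at step [i] with Pursuer at [p] and Evader at [e]. Only its values at
   distinct points of the disk matter. *)
Definition strategy := nat -> 'rV[K]_2 -> 'rV[K]_2 -> set ('rV[K]_2 * K).

Definition admissible (e : 'rV[K]_2) : set ('rV[K]_2 * K) :=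
  [set a | [/\ enorm a.1 <= 1, 0 < a.2 &
    forall s : K, 0 <= s <= a.2 -> disk (e + s *: a.1)]].

Definition piecewise_blind (F : strategy) : Prop :=
  forall (i : nat) (p e : 'rV[K]_2), disk p -> disk e -> p != e ->
    F i p e `<=` admissible e.

(* Oracle [true] is the representation of Pursuer's position and oracle
   [false] that of Evader's; the selected pair is represented as a point of
   the 3-dimensional space. *)
Definition computable_strategy (F : strategy) : Prop :=
  exists M : otm bool,
  forall (i : nat) (p e : 'rV[K]_2) (phi psi : nat -> 'rV[rat]_2),
    disk p -> disk e -> p != e -> represents phi p -> represents psi e ->
    exists (a : 'rV[K]_2 * K) (chi : nat -> 'rV[rat]_(2 + 1)),
      [/\ F i p e a,
          represents chi (row_mx a.1 (const_mx a.2)) &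
          forall k : nat,
            otm_outputs M (fun b => vec_oracle (if b then phi else psi))
              (code_nats [:: i; k]) (code_vec (chi k))].

(* Speed at most 1 is rendered as the 1-Lipschitz condition; only nonnegative
   times matter. *)
Definition pursuer_motion (P : K -> 'rV[K]_2) : Prop :=
  (forall t : K, 0 <= t -> disk (P t)) /\
  (forall s t : K, 0 <= s -> s <= t -> enorm (P t - P s) <= t - s).

Definition step_time (a : nat -> 'rV[K]_2 * K) : nat -> K :=
  series (fun i => (a i).2).

Definition evader_at (e0 : 'rV[K]_2) (a : nat -> 'rV[K]_2 * K) (i : nat)
    : 'rV[K]_2 :=
  e0 + \sum_(0 <= j < i) (a j).2 *: (a j).1.

Definition consistent (F : strategy) (P : K -> 'rV[K]_2) (e0 : 'rV[K]_2)
    (a : nat -> 'rV[K]_2 * K) (i : nat) : Prop :=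
  F i (P (step_time a i)) (evader_at e0 a i) (a i).

(* Positions are required to differ during every initial part of a play whose
   selections are consistent, so that a strategy cannot win by having no
   selection left once Evader is caught. *)
Definition winning_from (F : strategy) (p0 e0 : 'rV[K]_2) : Prop :=
  forall (P : K -> 'rV[K]_2) (a : nat -> 'rV[K]_2 * K),
    pursuer_motion P -> P 0 = p0 ->
    (forall n : nat,
      (forall i : nat, (i <= n)%N -> consistent F P e0 a i) ->
      forall s : K, 0 <= s <= (a n).2 ->
        P (step_time a n + s) != evader_at e0 a n + s *: (a n).1) /\
    ((forall i : nat, consistent F P e0 a i) ->
      step_time a @ \oo --> +oo).

Definition winning (F : strategy) : Prop :=
  forall p0 e0 : 'rV[K]_2, disk p0 -> disk e0 -> p0 != e0 ->
    winning_from F p0 e0.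

End Game.

(* Main.v *)
From Pilot Require Import Defs.
From mathcomp Require Import all_boot all_order all_algebra.
From mathcomp Require Import all_classical all_reals all_analysis.
From mathcomp Require Import ring lra zify.
(* Again, because MathComp's [thead] on tuples shadows the one of [tape]. *)
Import Pilot.Defs.

Set Implicit Arguments.
Unset Strict Implicit.
Unset Printing Implicit Defensive.

Import Order.TTheory GRing.Theory Num.Theory.
Import numFieldNormedType.Exports.

(* Write [h = r^2 - |e|^2]. Evader may play any velocity [v], [|v| < 1], and
   delay [d] in ]0, 1[ such that Pursuer cannot reach the end point in time,
   [|e + d v - p| > d], [h] shrinks at most by the factor [1 - d], and
   [N d > h] for a constant [N] of the order of [r^2]. The gap between the
   players is bounded below by a concave function of time, so it is enough to
   look at the end point, and if the delays had a finite sum then [h] would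
   stay away from 0, hence so would the delays.

   All the conditions are strict polynomial inequalities, so Evader can search
   for rational [v] and [d] with approximations of [p], [e] and [r]. A move
   always exists: if [h] is not too small, move orthogonally to [e - p] on the
   side of the centre for a time [2 h / N], otherwise move towards the centre.
   In fact a precision [eps] much smaller than [|e - p|^2] suffices to find
   it. So the machine first looks for such a precision, which does not involve
   [r], then runs the given machine for [r] only once, which avoids the need
   of cleaning up its tapes, and finally enumerates the candidates. *)

(** * Fragments of oracle machines *)

(** The gap between the players has no positive lower bound over a play, so delays tied to it could
    form a convergent series. Here the delay is governed by [h] alone: if [v] is orthogonal to
    [e - p], then [|e + d v - p|^2 - d^2 = D - d^2 (1 - |v|^2)] with [D = |e - p|^2], so a close
    Pursuer forces a speed near 1 but not a short delay. The price is the boundary, where such a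
    move may leave the disk; the inward move brings [h] back from 0. Which of the two moves to take
    depends on whether [h] is small, which cannot be decided from representations. The distinction
    therefore occurs only in the existence proof; the strategy is the open set of all good moves,
    and different representations may lead to different elements of it. The precision search can do
    without the digits of [r] because two points of the disk satisfy [D <= 8 r^2]: a precision small
    against [D] is also small against [r^2]. Upper bounds on [r] enter the machine as fixed
    integers. *)

Section Fragments.
Variables (T : finType) (tq ta : T).

(* The successor state [None] is the exit of the fragment. *)
Record frag := Frag {
  fstate : finType;
  fentry : fstate;
  fcode : fstate -> {ffun T -> symbol} -> instr bool (option fstate) T
}.

Definition imap (S S' : finType) (f : S -> S') (i : instr bool S T) :
    instr bool S' T :=
  match i with
  | Halt => Halt
  | Query j q => Query _ j (f q)
  | Act q a => Act _ (f q) a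
  end.

Definition heads (c : T -> tape) : {ffun T -> symbol} :=
  [ffun x => thead (c x)].

Definition act_on (a : {ffun T -> symbol * dir}) (c : T -> tape) : T -> tape :=
  fun x => tape_move (a x).2 (tape_write (a x).1 (c x)).

(** An [Act] writes on every tape, so leaving a tape alone means rewriting the scanned symbol
    without moving. *)
Definition noop (s : {ffun T -> symbol}) : {ffun T -> symbol * dir} :=
  [ffun x => (s x, Stay)].

Lemma noopE (c : T -> tape) : act_on (noop (heads c)) c = c.
Proof. by apply/funext => x; rewrite /act_on !ffunE /=; case: (c x). Qed.

Definition touch (x : T) (w : symbol -> symbol * dir)
    (s : {ffun T -> symbol}) : {ffun T -> symbol * dir} :=
  [ffun y => if y == x then w (s y) else (s y, Stay)].

Definition basic (a : {ffun T -> symbol} -> {ffun T -> symbol * dir}) : frag :=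
  @Frag unit tt (fun _ s => Act _ None (a s)).

Definition skip : frag := basic noop.
Definition pop (x : T) : frag := basic (touch x (fun s => (s, MoveRight))).
Definition put (x : T) (b : bool) : frag :=
  basic (touch x (fun _ => (Some b, Stay))).
Definition query (j : bool) : frag :=
  @Frag unit tt (fun _ _ => Query _ j None).

Definition fseq (A B : frag) : frag :=
  @Frag (fstate A + fstate B)%type (inl (fentry A)) (fun q s =>
    match q with
    | inl q => imap (fun o => Some (if o is Some q' then inl q'
                                    else inr (fentry B))) (fcode q s)
    | inr q => imap (omap inr) (fcode q s)
    end).

Definition push (x : T) (b : bool) : frag :=
  fseq (basic (touch x (fun s => (s, MoveLeft)))) (put x b).

Definition fif (x : T) (A B : frag) : frag :=
  @Frag (option (fstate A + fstate B)%type) None (fun q s =>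
    match q with
    | None => Act _ (Some (Some (if s x == Some true then inl (fentry A)
                                 else inr (fentry B)))) (noop s)
    | Some (inl q) => imap (omap (Some \o inl)) (fcode q s)
    | Some (inr q) => imap (omap (Some \o inr)) (fcode q s)
    end).

Definition fwhile (x : T) (A : frag) : frag :=
  @Frag (option (fstate A)) None (fun q s =>
    match q with
    | None => Act _ (if s x == Some true then Some (Some (fentry A)) else None)
                  (noop s)
    | Some q => imap Some (fcode q s)
    end).

Section Reach.
Variable O : bool -> nat -> word.

Definition ask (j : bool) (c : T -> tape) : T -> tape :=
  fun x => if x == ta then word_tape (O j (size (tape_word (c tq)))) else c x.

Inductive reach (F : frag) : option (fstate F) -> (T -> tape) ->
    option (fstate F) -> (T -> tape) -> Prop :=
  | reach_refl q c : reach q c q c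
  | reach_act q c q' a r d : fcode q (heads c) = Act _ q' a ->
      reach q' (act_on a c) r d -> reach (Some q) c r d
  | reach_query q c j q' r d : fcode q (heads c) = Query _ j q' ->
      reach q' (ask j c) r d -> reach (Some q) c r d.

Lemma reach_trans F q1 c1 q2 c2 q3 c3 :
  @reach F q1 c1 q2 c2 -> @reach F q2 c2 q3 c3 -> @reach F q1 c1 q3 c3.
Proof.
elim=> [//|q c q' a r d e _ IH /IH|q c j q' r d e _ IH /IH].
  exact: reach_act e.
exact: reach_query e.
Qed.

(** Sequences, branches and loops contain their parts up to a renaming of states; only the image of
    the exit [None] under [f] varies, and it says where control goes next. *)
Lemma reach_embed (A B : frag) (iota : fstate A -> fstate B)
    (f : option (fstate A) -> option (fstate B)) :
  (forall q, f (Some q) = Some (iota q)) ->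
  (forall q s, fcode (iota q) s = imap f (fcode q s)) ->
  forall q c q' c', @reach A q c q' c' -> @reach B (f q) c (f q') c'.
Proof.
move=> fS fE q c q' c'; elim=> [*|{}q {}c {}q' a r d e _ IH|
  {}q {}c j {}q' r d e _ IH]; first exact: reach_refl.
  by rewrite fS; apply: reach_act IH; rewrite fE e.
by rewrite fS; apply: reach_query IH; rewrite fE e.
Qed.

Definition cruns (F : frag) (c c' : T -> tape) : Prop :=
  reach (Some (fentry F)) c None c'.

Lemma cruns_basic a c : cruns (basic a) c (act_on (a (heads c)) c).
Proof. by apply: reach_act; [|exact: reach_refl]. Qed.

Lemma cruns_query j c : cruns (query j) c (ask j c).
Proof. by apply: reach_query; [|exact: reach_refl]. Qed.

Lemma cruns_seq A B c d e : cruns A c d -> cruns B d e -> cruns (fseq A B) c e.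
Proof.
move=> Acd Bde.
apply: (@reach_trans _ _ _ (Some (inr (fentry B) : fstate (fseq A B))) d).
  pose f (o : option (fstate A)) : option (fstate (fseq A B)) :=
    Some (if o is Some q' then inl q' else inr (fentry B)).
  exact: (@reach_embed A (fseq A B) inl f (fun _ => erefl) (fun _ _ => erefl)
    _ _ _ _ Acd).
exact: (@reach_embed B (fseq A B) inr (omap inr) (fun _ => erefl)
  (fun _ _ => erefl) _ _ _ _ Bde).
Qed.

Lemma cruns_if x A B c d :
  cruns (if thead (c x) == Some true then A else B) c d ->
  cruns (fif x A B) c d.
Proof.
rewrite /cruns => H; apply: reach_act; first by rewrite /=.
rewrite noopE ffunE; case: ifP H => _ H.
  exact: (@reach_embed A (fif x A B) (Some \o inl) (omap (Some \o inl))
    (fun _ => erefl) (fun _ _ => erefl) _ _ _ _ H).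
exact: (@reach_embed B (fif x A B) (Some \o inr) (omap (Some \o inr))
  (fun _ => erefl) (fun _ _ => erefl) _ _ _ _ H).
Qed.

Lemma cruns_while0 x A c :
  thead (c x) != Some true -> cruns (fwhile x A) c c.
Proof.
move=> cx; apply: reach_act; first by rewrite /=.
by rewrite noopE ffunE (negPf cx); exact: reach_refl.
Qed.

Lemma cruns_whileS x A c d e :
  thead (c x) == Some true -> cruns A c d -> cruns (fwhile x A) d e ->
  cruns (fwhile x A) c e.
Proof.
move=> cx Acd; apply: reach_trans; apply: reach_act; first by rewrite /=.
rewrite noopE ffunE cx.
(* The renaming [Some] sends the exit [None] of the body to [Some None], the test state of the
   loop. *)
exact: (@reach_embed A (fwhile x A) Some Some (fun _ => erefl)
  (fun _ _ => erefl) _ _ _ _ Acd).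
Qed.

(* Partial knowledge of a tape; a tape known by its word is used as a stack,
   whatever lies beyond the word. *)
Inductive know := Exact of tape | Word of word.

Definition knows (t : tape) (k : know) : Prop :=
  match k with Exact t' => t = t' | Word w => tape_word t = w end.

Definition kpush (b : bool) (k : know) : know :=
  match k with
  | Exact t => Exact (tape_write (Some b) (tape_move MoveLeft t))
  | Word w => Word (b :: w)
  end.

Definition khead (k : know) : symbol :=
  match k with Exact t => thead t | Word w => ohead w end.

Definition store := T -> know.

Definition upd (S : Type) (k : T -> S) (x : T) (a : S) : T -> S :=
  fun y => if y == x then a else k y.

Definition models (c : T -> tape) (k : store) : Prop :=
  forall x, knows (c x) (k x).

(** A triple with termination. It ranges over all tapes described by [k], since the cells beyond a
    known word may hold anything. *)
Variant runs (F : frag) (k k' : store) : Prop :=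
  Runs of forall c, models c k -> exists2 c', cruns F c c' & models c' k'.

Lemma thead_knows t k : knows t k -> thead t = khead k.
Proof.
by case: k => [t' ->//|w <-]; case: t => l [h|] r.
Qed.

Lemma word_tapeK w : tape_word (word_tape w) = w.
Proof. by case: w => // b v; congr cons; elim: v => //= ? ? ->. Qed.

Lemma word_prefix_next (r : seq symbol) :
  word_prefix (head None r :: behead r) = word_prefix r.
Proof. by case: r. Qed.

Lemma tape_word_pop b w t :
  tape_word t = b :: w -> tape_word (tape_move MoveRight t) = w.
Proof.
case: t => l h r; case: h => [h|] //; rewrite /tape_word.
by rewrite [thead _]/= [tright _]/= word_prefix_next => -[_].
Qed.

Lemma act_touch x (w : symbol -> symbol * dir) c :
  act_on (touch x w (heads c)) c =
  upd c x (tape_move (w (thead (c x))).2 (tape_write (w (thead (c x))).1 (c x))).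
Proof.
apply/funext => y; rewrite /act_on /upd !ffunE; case: eqVneq => [->//|_].
by case: (c y).
Qed.

Lemma models_upd x c k t k' :
  models c k -> knows t k' -> models (upd c x t) (upd k x k').
Proof. by move=> ck tk' y; rewrite /upd; case: eqP. Qed.

Lemma runs_seq A B k k1 k2 :
  runs A k k1 -> runs B k1 k2 -> runs (fseq A B) k k2.
Proof.
case=> HA [HB]; split=> c /HA[d cd /HB[e de me]]; exists e => //.
exact: cruns_seq cd de.
Qed.

Lemma runs_skip k : runs skip k k.
Proof.
by split=> c ck; exists (act_on (noop (heads c)) c);
  [exact: cruns_basic | rewrite noopE].
Qed.

Lemma runs_push x b k : runs (push x b) k (upd k x (kpush b (k x))).
Proof.
split=> c ck; eexists; first exact: cruns_seq (cruns_basic _ _) (cruns_basic _ _).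
rewrite !act_touch.
have -> t u : upd (upd c x t) x u = upd c x u.
  by apply/funext => y; rewrite /upd; case: eqP.
apply: models_upd => //; rewrite /upd eqxx.
by have := ck x; case: (k x) => [t ->|w <-]; case: (c x).
Qed.

Lemma runs_pop x k b w :
  k x = Word (b :: w) -> runs (pop x) k (upd k x (Word w)).
Proof.
move=> kx; split=> c ck; eexists; first exact: cruns_basic.
rewrite act_touch; apply: models_upd => //; have := ck x; rewrite kx.
by case: (c x) => l h r; exact: tape_word_pop.
Qed.

Lemma runs_put_exact x b k t :
  k x = Exact t -> runs (put x b) k (upd k x (Exact (tape_write (Some b) t))).
Proof.
move=> kx; split=> c ck; eexists; first exact: cruns_basic.
by rewrite act_touch; apply: models_upd => //=; have := ck x; rewrite kx => ->.
Qed.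

Lemma runs_query j k w :
  k tq = Word w -> runs (query j) k (upd k ta (Word (O j (size w)))).
Proof.
move=> kq; split=> c ck; exists (ask j c); first exact: cruns_query.
move=> y; rewrite /ask /upd; case: eqP => // _.
by have := ck tq; rewrite kq => <-; exact: word_tapeK.
Qed.

Lemma runs_if x A B k k' :
  runs (if khead (k x) == Some true then A else B) k k' ->
  runs (fif x A B) k k'.
Proof.
move=> H; split=> c ck; rewrite -(thead_knows (ck x)) in H.
case: H => /(_ c ck)[d cd dk]; exists d => //; exact: cruns_if.
Qed.

Lemma runs_while0 x A k :
  khead (k x) != Some true -> runs (fwhile x A) k k.
Proof.
move=> H; split=> c ck; rewrite -(thead_knows (ck x)) in H.
by exists c => //; exact: cruns_while0.
Qed.

Lemma runs_whileS x A k k1 k2 :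
  khead (k x) == Some true -> runs A k k1 -> runs (fwhile x A) k1 k2 ->
  runs (fwhile x A) k k2.
Proof.
move=> H [HA] [HW]; split=> c ck; rewrite -(thead_knows (ck x)) in H.
have [d cd dk] := HA c ck; have [e de ek] := HW d dk.
by exists e => //; exact: cruns_whileS H cd de.
Qed.

End Reach.

Section Machine.
Variables (tin tout : T) (F : frag).
Hypothesis tU : uniq [:: tin; tq; ta; tout].

Definition frag_otm : otm bool :=
  @OTM bool (option (fstate F)) T (Some (fentry F)) tin tq ta tout tU
    (fun q s => if q is Some q' then fcode q' s else Halt).

Lemma reach_outputs O q c q' c' :
  @reach O F q c q' c' ->
  exists n, iter n (obind (otm_step O)) (Some (@Config bool frag_otm q c)) =
            Some (@Config bool frag_otm q' c').
Proof.
elim=> [|{}q {}c {}q' a r d e _ [n IH]|{}q {}c j {}q' r d e _ [n IH]] *.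
- by exists 0%N.
- exists n.+1; rewrite iterSr /= -IH; congr iter; rewrite /otm_step /=.
  by have -> : [ffun x => thead (c x)] = heads c by []; rewrite e.
- exists n.+1; rewrite iterSr /= -IH; congr iter; rewrite /otm_step /=.
  by have -> : [ffun x => thead (c x)] = heads c by []; rewrite e.
Qed.

Lemma runs_outputs O (k k' : store) w w' :
  models (ctape (otm_init frag_otm w)) k -> runs O F k k' ->
  k' tout = Word w' -> otm_outputs frag_otm O w w'.
Proof.
move=> mk [/(_ _ mk)[c' cc' mc']] kw.
have [n Hn] := reach_outputs cc'.
exists n; eexists; split; [exact: Hn|by []|].
by have := mc' tout; rewrite kw.
Qed.

End Machine.

End Fragments.

(** * Calling a machine without oracle as a subroutine *)

Section Subroutine.
Variables (S : finType) (M : otm void).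

Local Notation T := (S + otm_tapes M)%type.

(** The tapes of [M] are a separate summand, hence untouched before the call except for its input.
    Halting becomes the exit of the fragment, and the query case is empty because the oracles are
    indexed by [void]. *)
Definition sub_frag : frag T :=
  @Frag T (otm_state M) (otm_start M) (fun q s =>
    match otm_prog q [ffun x => s (inr x)] with
    | Halt => Act _ None (noop s)
    | Query j _ => match j with end
    | Act q' a => Act _ (Some q') [ffun x =>
        match x with inl _ => (s x, Stay) | inr y => a y end]
    end).

Lemma sub_frag_reach (tq ta : T) O n q c q' c' :
  iter n (obind (otm_step no_oracle)) (Some (Config (M := M) q (c \o inr))) =
    Some (Config (M := M) q' c') ->
  exists2 d, @reach T tq ta O sub_frag (Some q) c (Some q') d &
    (forall x, d (inl x) = c (inl x)) /\ d \o inr = c'.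
Proof.
elim: n q c => [|n IH] q c.
  by move=> /= -[<- <-]; exists c => //; exact: reach_refl.
rewrite iterSr /= {2}/otm_step /=.
have -> : [ffun x => thead ((c \o inr) x)] = [ffun x => heads c (inr x)].
  by apply/ffunP => x; rewrite !ffunE.
case E: (otm_prog q _) => [|[]|q1 a].
  suff -> : iter n (obind (otm_step no_oracle)) None = None :> option (config M).
    by [].
  by elim: n {IH} => //= n ->.
pose c1 := act_on [ffun x =>
  match x with inl _ => (heads c x, Stay) | inr y => a y end] c.
have -> : (fun x => tape_move (a x).2 (tape_write (a x).1 ((c \o inr) x))) =
   c1 \o inr.
  by apply/funext => x; rewrite /c1 /act_on /= ffunE.
move=> /IH[d qd [dl dr]]; exists d.
  by apply: reach_act qd; rewrite /= E.
split=> // x; rewrite dl /c1 /act_on /= !ffunE /=.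
by case: (c (inl x)).
Qed.

(** A foreign machine may read any cell, so its initial tapes must be known entirely and not just by
    their words; this is the purpose of [Exact]. *)
Lemma sub_frag_runs (tq ta : T) O (k : store T) w w' :
  otm_outputs M no_oracle w w' ->
  (forall y, k (inr y) = Exact (ctape (otm_init M w) y)) ->
  exists2 k', runs tq ta O sub_frag k k' &
    (forall x, k' (inl x) = k (inl x)) /\ k' (inr (otm_out M)) = Word w'.
Proof.
move=> [n [[q t] [Hn Hs Hw]]] ki.
pose k' : store T := fun x => match x with inl _ => k x
  | inr y => Exact (t y) end.
exists (upd k' (inr (otm_out M)) (Word w')).
  split=> c ck.
  have cE : Some (Config (M := M) (otm_start M) (c \o inr)) =
     Some (otm_init M w).
    congr Some; rewrite /otm_init; congr Config; apply/funext => y /=.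
    by have := ck (inr y); rewrite ki.
  rewrite -cE in Hn; have [d cd [dl dr]] := sub_frag_reach tq ta O Hn.
  exists d.
    apply: (reach_trans cd); apply: (@reach_act _ _ _ _ sub_frag _ _ None).
      rewrite /=; move: Hs; rewrite /otm_step /=.
      have -> : [ffun x => thead (t x)] = [ffun x => heads d (inr x)].
        by apply/ffunP => x; rewrite !ffunE -dr.
      by case: (otm_prog q _) => [_|[]|//]; reflexivity.
    by rewrite noopE; exact: reach_refl.
  move=> [x|y]; rewrite /upd /k' /=.
    by have := ck (inl x); rewrite dl.
  have -> : d (inr y) = t y by rewrite -dr.
  case: eqP => [[->]|//]; exact: Hw.
by split=> [x|]; rewrite /upd ?eqxx.
Qed.

End Subroutine.

(** * Arithmetic on stacks *)

Section Programs.
Variables (T : finType) (W A B C : T).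
Hypothesis WABC : uniq [:: W; A; B; C].

Inductive nexp :=
  | NReg of T
  | NCst of nat
  | NAdd of nexp & nexp
  | NSub of nexp & nexp
  | NMul of nexp & nexp.

Fixpoint neval (v : T -> nat) (e : nexp) : nat :=
  match e with
  | NReg x => v x
  | NCst n => n
  | NAdd e1 e2 => neval v e1 + neval v e2
  | NSub e1 e2 => neval v e1 - neval v e2
  | NMul e1 e2 => neval v e1 * neval v e2
  end.

Definition unary (n : nat) : know := Word (nseq n true).

Fixpoint nreads (v : T -> nat) (k : store T) (e : nexp) : Prop :=
  match e with
  | NReg x => x \notin [:: W; A; B; C] /\ k x = unary (v x)
  | NCst _ => True
  | NAdd e1 e2 | NSub e1 e2 | NMul e1 e2 => nreads v k e1 /\ nreads v k e2
  end.

Definition pushes (ys : seq T) : frag T :=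
  foldr (fun y f => fseq (push y true) f) (skip T) ys.

(* Moves the block of [true] on top of [x] to every stack of [ys]. *)
Definition drain (x : T) (ys : seq T) : frag T :=
  fwhile x (fseq (pop x) (pushes ys)).

Definition take_nat (x : T) (ys : seq T) : frag T := fseq (drain x ys) (pop x).

(** Postfix evaluation on the stack [W], in blocks of [true] closed by [false]. Reading is
    destructive, so a register is moved to [A] and then back to itself and to [W]. In a product the
    first factor travels between [B] and [C], once for each unit of the second. *)
Fixpoint compute (e : nexp) : frag T :=
  match e with
  | NReg x => fseq (push W false) (fseq (drain x [:: A]) (drain A [:: x; W]))
  | NCst n => fseq (push W false) (pushes (nseq n W))
  | NAdd e1 e2 => fseq (compute e1) (fseq (compute e2)
      (fseq (take_nat W [:: A]) (drain A [:: W])))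
  | NSub e1 e2 => fseq (compute e1) (fseq (compute e2)
      (fseq (take_nat W [:: A])
            (fwhile A (fseq (pop A) (fif W (pop W) (skip T))))))
  | NMul e1 e2 => fseq (compute e1) (fseq (compute e2)
      (fseq (take_nat W [:: A]) (fseq (take_nat W [:: B])
      (fseq (push W false)
      (fseq (fwhile A (fseq (pop A) (fseq (drain B [:: C; W]) (drain C [:: B]))))
            (drain B [::]))))))
  end.

Section Runs.
Variables (tq ta : T) (O : bool -> nat -> word).

Local Notation runs := (runs tq ta O).

(** Multiplicities in [ys] count, so that pushing a constant [n] is the case [nseq n W]. *)
Definition pushed (k : store T) (ys : seq T) (n : nat) : store T :=
  fun z => iter (n * count_mem z ys) (kpush true) (k z).

Lemma iter_kpush n w : iter n (kpush true) (Word w) = Word (nseq n true ++ w).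
Proof. by elim: n => //= n ->. Qed.

Lemma runs_pushes k ys : runs (pushes ys) k (pushed k ys 1).
Proof.
elim: ys k => [|y ys IH] k /=.
  suff -> : pushed k [::] 1 = k by exact: runs_skip.
  by apply/funext => z; rewrite /pushed muln0.
apply: runs_seq (runs_push _ _ _ _ _ _) _.
suff -> : pushed k (y :: ys) 1 = pushed (upd k y (kpush true (k y))) ys 1.
  exact: IH.
apply/funext => z; rewrite /pushed /upd /= !mul1n eq_sym.
by case: eqVneq => [->|//] /=; rewrite -iterSr.
Qed.

Lemma runs_drain k x ys n w :
  x \notin ys -> ohead w != Some true -> k x = Word (nseq n true ++ w) ->
  runs (drain x ys) k (upd (pushed k ys n) x (Word w)).
Proof.
move=> xys hw; elim: n k => [|n IH] k kx.
  suff -> : upd (pushed k ys 0) x (Word w) = k by apply: runs_while0; rewrite kx.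
  by apply/funext => z; rewrite /upd /pushed mul0n /=; case: eqP => // ->.
pose k1 := pushed (upd k x (Word (nseq n true ++ w))) ys 1.
apply: (@runs_whileS _ _ _ _ _ _ _ k1).
- by rewrite kx.
- by apply: runs_seq (runs_pushes _ _); exact: runs_pop kx.
suff -> : upd (pushed k ys n.+1) x (Word w) = upd (pushed k1 ys n) x (Word w).
  by apply: IH; rewrite /k1 /pushed /upd eqxx (count_memPn xys).
apply/funext => z; rewrite /k1 /upd /pushed; case: eqP => // _.
by rewrite -iterD mul1n mulSn addnC.
Qed.

Lemma runs_take_nat k x ys n w :
  x \notin ys -> k x = Word (code_nat n ++ w) ->
  runs (take_nat x ys) k (upd (pushed k ys n) x (Word w)).
Proof.
rewrite /code_nat -cats1 -catA => xys kx.
apply: runs_seq; first by apply: (runs_drain xys _ kx).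
suff -> : upd (pushed k ys n) x (Word w) =
   upd (upd (pushed k ys n) x (Word (false :: w))) x (Word w).
  by apply: (@runs_pop _ _ _ _ _ _ false); rewrite /upd eqxx.
by apply/funext => z; rewrite /upd; case: eqP.
Qed.

Lemma runs_eq F k k1 k2 : runs F k k1 -> k1 =1 k2 -> runs F k k2.
Proof. by move=> H /funext <-. Qed.

Lemma nreads_upd v k e w : nreads v k e -> nreads v (upd k W w) e.
Proof.
elim: e => //= [x|e1 I1 e2 I2|e1 I1 e2 I2|e1 I1 e2 I2]; last 3 first.
- by case=> /I1 ? /I2.
- by case=> /I1 ? /I2.
- by case=> /I1 ? /I2.
by rewrite /upd; case: eqVneq => // ->; rewrite !inE eqxx => -[].
Qed.

Lemma pushed1 k y n : pushed k [:: y] n = upd k y (iter n (kpush true) (k y)).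
Proof.
apply/funext => z; rewrite /pushed /upd /= addn0 eq_sym.
by case: eqVneq => [->|_]; rewrite ?muln1 ?muln0.
Qed.

Lemma pushed2 k y1 y2 n : y1 != y2 ->
  pushed k [:: y1; y2] n = upd (upd k y1 (iter n (kpush true) (k y1)))
                             y2 (iter n (kpush true) (k y2)).
Proof.
move=> y12; apply/funext => z; rewrite /pushed /upd /= addn0 ![_ == z]eq_sym.
case: (eqVneq z y2) => [->|_]; first by rewrite eq_sym (negPf y12) muln1.
by case: eqVneq => [->|_]; rewrite ?muln1 ?muln0.
Qed.

Lemma scratch_neq : ((W == A) = false) * ((W == B) = false) * ((W == C) = false) *
  ((A == W) = false) * ((A == B) = false) * ((A == C) = false) *
  ((B == W) = false) * ((B == A) = false) * ((B == C) = false) *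
  ((C == W) = false) * ((C == A) = false) * ((C == B) = false).
Proof.
move: WABC; rewrite /= !inE !negb_or ![_ == W]eq_sym ![_ == A]eq_sym.
rewrite ![_ == B]eq_sym.
by case/and4P => /and3P[/negPf-> /negPf-> /negPf->] /andP[/negPf-> /negPf->]
  /negPf->.
Qed.

Lemma runs_compute v k e w :
  nreads v k e -> k W = Word w -> k A = unary 0 -> k B = unary 0 -> k C = unary 0 ->
  runs (compute e) k (upd k W (Word (code_nat (neval v e) ++ w))).
Proof.
elim: e k w => [x|n|e1 I1 e2 I2|e1 I1 e2 I2|e1 I1 e2 I2] k w /=.
- move=> [xr kx] kW kA kB kC.
  have [xW xA] : (x == W) = false /\ (x == A) = false.
    by move: xr; rewrite !inE !negb_or => /and4P[/negPf ? /negPf ?].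
  have [Wx Ax] : (W == x) = false /\ (A == x) = false by rewrite ![_ == x]eq_sym.
  apply: runs_seq (runs_push _ _ _ _ _ _) _.
  apply: runs_seq.
    apply: (@runs_drain _ _ _ (v x) [::]) => //; first by rewrite inE xA.
    by rewrite cats0 /upd xW kx.
  rewrite pushed1; apply: runs_eq.
    apply: (@runs_drain _ _ _ (v x) [::]) => //.
      by rewrite !inE Ax scratch_neq.
    by rewrite cats0 /upd eqxx Ax scratch_neq kA iter_kpush cats0.
  rewrite pushed2 ?xW // => z; rewrite /upd eqxx xW xA Wx ?Ax !scratch_neq.
  case: (eqVneq z A) => [->|zA]; first by rewrite !scratch_neq kA.
  case: (eqVneq z W) => [_|zW].
    by rewrite kW /kpush iter_kpush /code_nat -cats1 -catA.
  by case: (eqVneq z x) => // ->; rewrite eqxx iter_kpush cats0 kx.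
- move=> _ kW kA kB kC.
  apply: runs_seq (runs_push _ _ _ _ _ _) _.
  apply: runs_eq; first exact: runs_pushes.
  move=> z; rewrite /pushed /upd count_nseq mul1n /= eq_sym.
  case: (eqVneq z W) => [_|_]; last by rewrite mul0n.
  by rewrite mul1n kW iter_kpush /code_nat -cats1 -catA.
- move=> [k1 k2] kW kA kB kC.
  apply: runs_seq (I1 _ _ k1 kW kA kB kC) _.
  apply: runs_seq.
    by apply: I2; rewrite /upd ?eqxx ?scratch_neq; first exact: nreads_upd.
  apply: runs_seq.
    by apply: runs_take_nat; rewrite ?inE ?scratch_neq // /upd eqxx.
  rewrite pushed1; apply: runs_eq.
    apply: (@runs_drain _ _ _ (neval v e2) [::]) => //.
      by rewrite inE scratch_neq.
    by rewrite /upd !scratch_neq eqxx kA iter_kpush.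
  move=> z; rewrite pushed1 /upd !scratch_neq eqxx.
  case: (eqVneq z A) => [->|_]; first by rewrite !scratch_neq kA.
  case: (eqVneq z W) => // _.
  by rewrite /code_nat -!cats1 -!catA iter_kpush addnC nseqD catA.
- move=> [k1 k2] kW kA kB kC.
  apply: runs_seq (I1 _ _ k1 kW kA kB kC) _.
  apply: runs_seq.
    by apply: I2; rewrite /upd ?eqxx ?scratch_neq; first exact: nreads_upd.
  apply: runs_seq.
    by apply: runs_take_nat; rewrite ?inE ?scratch_neq // /upd eqxx.
  rewrite pushed1 /upd !scratch_neq.
  set k3 := (X in runs _ X).
  have {k3} -> : k3 = upd (upd k A (unary (neval v e2)))
      W (Word (nseq (neval v e1) true ++ false :: w)).
    apply/funext => z; rewrite /k3 /upd.
    case: (eqVneq z W) => // _; first by rewrite /code_nat -cats1 -catA.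
    by case: (eqVneq z A) => // _; rewrite kA iter_kpush cats0.
  elim: (neval v e2) (neval v e1) => [|m IH] n.
    apply: runs_eq; first by apply: runs_while0; rewrite /upd scratch_neq eqxx.
    move=> z; rewrite /upd subn0 /code_nat -cats1 -catA.
    by case: (eqVneq z W) => // _; case: (eqVneq z A) => // ->.
  (* One round of the loop takes the predecessor; at 0 the branch skips the pop, in accordance with
     truncated subtraction. *)
  have -> : (n - m.+1 = n.-1 - m)%N by lia.
  apply: (runs_whileS _ _ (IH n.-1)); first by rewrite /upd scratch_neq eqxx.
  apply: runs_seq.
    by apply: (@runs_pop _ _ _ _ _ _ true (nseq m true)); rewrite /upd scratch_neq eqxx.
  apply: runs_if; rewrite /upd scratch_neq eqxx; case: n => [|n] /=.
    apply: runs_eq; first exact: runs_skip.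
    move=> z /=; case: (eqVneq z A) => [->|_] //; by rewrite scratch_neq.
  apply: runs_eq.
    apply: (@runs_pop _ _ _ _ _ _ true).
    by rewrite scratch_neq eqxx.
  move=> z; rewrite /upd; case: (eqVneq z A) => [->|_] //; by case: (eqVneq z W).
- move=> [k1 k2] kW kA kB kC.
  apply: runs_seq (I1 _ _ k1 kW kA kB kC) _.
  apply: runs_seq.
    by apply: I2; rewrite /upd ?eqxx ?scratch_neq; first exact: nreads_upd.
  apply: runs_seq.
    by apply: runs_take_nat; rewrite ?inE ?scratch_neq // /upd eqxx.
  rewrite pushed1; apply: runs_seq.
    by apply: runs_take_nat; rewrite ?inE ?scratch_neq // /upd ?eqxx ?scratch_neq ?eqxx.
  rewrite pushed1; apply: runs_seq (runs_push _ _ _ _ _ _) _.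
  set m := neval v e1; set n := neval v e2.
  set k3 := (X in runs _ X).
  have {k3} -> : k3 = upd (upd (upd k A (unary n)) B (unary m)) W (Word (false :: w)).
    apply/funext => z; rewrite /k3 /upd !scratch_neq ?eqxx.
    case: (eqVneq z W) => // _; case: (eqVneq z B) => [_|_].
      by rewrite kB iter_kpush cats0.
    by case: (eqVneq z A) => [_|//]; rewrite kA iter_kpush cats0.
  apply: (@runs_seq _ _ _ _ _ _ _
    (upd (upd (upd k A (unary 0)) B (unary m)) W (Word (nseq (m * n) true ++ false :: w)))).
    (* Generalised over the part [q] of the product that is already on [W]. *)
    suff H q : runs (fwhile A (fseq (pop A) (fseq (drain B [:: C; W])
          (drain C [:: B]))))
        (upd (upd (upd k A (unary n)) B (unary m)) W (Word (nseq q true ++ false :: w)))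
        (upd (upd (upd k A (unary 0)) B (unary m)) W
          (Word (nseq (q + m * n) true ++ false :: w))).
      exact: (H 0%N).
    elim: n q => [|n IH] q.
      by rewrite muln0 addn0; apply: runs_while0; rewrite /upd !scratch_neq eqxx.
    have := IH (q + m)%N; rewrite -addnA -mulnS => /(runs_whileS _ _); apply.
      by rewrite /upd !scratch_neq eqxx.
    apply: runs_seq.
      by apply: (@runs_pop _ _ _ _ _ _ true (nseq n true)); rewrite /upd !scratch_neq eqxx.
    apply: runs_seq.
      apply: (@runs_drain _ _ _ m [::]) => //; first by rewrite !inE !scratch_neq.
      by rewrite /upd !scratch_neq eqxx cats0.
    rewrite pushed2 ?scratch_neq //; apply: runs_eq.
      apply: (@runs_drain _ _ _ m [::]) => //; first by rewrite !inE !scratch_neq.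
      by rewrite /upd !scratch_neq eqxx kC iter_kpush.
    move=> z; rewrite pushed1 /upd !scratch_neq ?eqxx kC.
    case: (eqVneq z C) => [->|_]; first by rewrite !scratch_neq kC.
    case: (eqVneq z B) => [->|_]; first by rewrite !scratch_neq iter_kpush cats0.
    case: (eqVneq z W) => [_|_]; last by case: (eqVneq z A).
    by rewrite iter_kpush addnC nseqD catA.
  apply: runs_eq.
    apply: (@runs_drain _ _ _ m [::]) => //.
    by rewrite /upd !scratch_neq eqxx cats0.
  move=> z; rewrite /pushed /= muln0 /upd.
  case: (eqVneq z B) => [->|_]; first by rewrite !scratch_neq kB.
  case: (eqVneq z W) => // _; first by rewrite /code_nat -cats1 -catA.
  by case: (eqVneq z A) => [->|] //.
Qed.

End Runs.
End Programs.

(** * Searching *)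

Section Odometer.
Variables (T : eqType) (n : T).
Implicit Types (v t : T -> nat) (xs : seq T).

Local Notation updv v x a := (fun y => if y == x then a else v y).

(* All the digits [xs] range over 0, ..., [v n]; the bound [v n] itself is
   incremented when they all overflow. *)
Fixpoint tickv (xs : seq T) (v : T -> nat) : T -> nat :=
  match xs with
  | [::] => updv v n (v n).+1
  | x :: xs' => if (v x < v n)%N then updv v x (v x).+1
                else tickv xs' (updv v x 0%N)
  end.

Definition ticks xs v v' : Prop := exists m, iter m (tickv xs) v = v'.

Lemma ticks_trans xs v1 v2 v3 :
  ticks xs v1 v2 -> ticks xs v2 v3 -> ticks xs v1 v3.
Proof. by move=> [i <-] [j <-]; exists (j + i)%N; rewrite iterD. Qed.

Lemma tickv_notin xs v x : x \notin n :: xs -> tickv xs v x = v x.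
Proof.
elim: xs v => [|y xs IH] v /=; rewrite !inE.
  by move/negPf->.
rewrite !negb_or => /and3P[xn xy xxs]; case: ifP => _; first by rewrite (negPf xy).
by rewrite IH ?inE ?negb_or ?xn // (negPf xy).
Qed.

Lemma ticks_head x xs v j : x != n -> v x = 0%N -> (j <= v n)%N ->
  ticks (x :: xs) v (updv v x j).
Proof.
move=> xn vx; elim: j => [|j IH] jn.
  by exists 0%N; apply/funext => y /=; case: eqP => // ->.
apply: (ticks_trans (IH (ltnW jn))); exists 1%N => /=.
rewrite eqxx eq_sym (negPf xn) jn.
by apply/funext => y; case: eqP.
Qed.

(** Each tick of the other digits is simulated by a full revolution of [x], up to the bound and back
    to 0. *)
Lemma ticks_cons x xs v v' : x \notin n :: xs -> v x = 0%N ->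
  ticks xs v v' -> ticks (x :: xs) v v' /\ v' x = 0%N.
Proof.
move=> xnxs vx [m <-]; elim: m => [|m [IH1 IH2]] /=.
  by split=> //; exists 0%N.
have xn : x != n by move: xnxs; rewrite inE negb_or => /andP[].
set w := iter m (tickv xs) v in IH1 IH2 *.
split; last by rewrite tickv_notin.
apply: (ticks_trans IH1); apply: (ticks_trans (ticks_head xs xn IH2 (leqnn _))).
exists 1%N => /=; rewrite eqxx eq_sym (negPf xn) ltnn; congr tickv.
by apply/funext => y; case: eqP => // ->.
Qed.

Lemma ticks_bound xs v : uniq (n :: xs) -> (forall x, x \in xs -> v x = 0%N) ->
  ticks xs v (updv v n (v n).+1).
Proof.
elim: xs => [|x xs IH]; first by exists 1%N.
rewrite /= inE negb_or => /and3P[/andP[nx nxs] xxs uxs] v0.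
have : ticks xs v (updv v n (v n).+1).
  by apply: IH => [/=|y yxs]; [rewrite nxs | rewrite v0 // inE yxs orbT].
case/(@ticks_cons x); rewrite ?inE ?negb_or 1?eq_sym ?nx //.
by rewrite v0 ?inE ?eqxx.
Qed.

Lemma ticks_digits xs v t : uniq (n :: xs) ->
  (forall x, x \in xs -> v x = 0%N) -> (forall x, x \in xs -> (t x <= v n)%N) ->
  ticks xs v (fun z => if z \in xs then t z else v z).
Proof.
elim: xs => [|x xs IH]; first by exists 0%N.
rewrite /= inE negb_or => /and3P[/andP[nx nxs] xxs uxs] v0 tn.
have : ticks xs v (fun z => if z \in xs then t z else v z).
  apply: IH => [/=|y yxs|y yxs]; first by rewrite nxs.
    by rewrite v0 // inE yxs orbT.
  by rewrite tn // inE yxs orbT.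
case/(@ticks_cons x).
- by rewrite inE negb_or eq_sym nx.
- by rewrite v0 ?inE ?eqxx.
move=> H Hx; apply: (ticks_trans H).
set w := (fun z => _) in H Hx *.
have -> : (fun z => if z \in x :: xs then t z else v z) = updv w x (t x).
  by apply/funext => z; rewrite /w inE; case: eqP => // ->.
apply: ticks_head => //; first by rewrite eq_sym.
by rewrite /w (negPf nxs) tn // inE eqxx.
Qed.

(** The enumeration is exhaustive: full revolutions raise the bound to [t n] with all digits at 0,
    and then the digits are set, the slowest one first. *)
Lemma ticks_reach xs v t : uniq (n :: xs) ->
  (forall x, x \in n :: xs -> v x = 0%N) ->
  (forall x, x \in xs -> (t x <= t n)%N) ->
  exists m, forall x, x \in n :: xs -> iter m (tickv xs) v x = t x.
Proof.
move=> U v0 tn.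
have vxs x : x \in xs -> v x = 0%N by move=> xxs; rewrite v0 // inE xxs orbT.
have nxs : n \notin xs by case/andP: U.
have H j : ticks xs v (updv v n j).
  elim: j => [|j IH].
    by exists 0%N; apply/funext => y /=; case: eqP => // ->; rewrite v0 ?inE ?eqxx.
  apply: (ticks_trans IH).
  have -> : updv v n j.+1 = updv (updv v n j) n ((updv v n j) n).+1.
    by apply/funext => y; rewrite eqxx; case: eqP.
  apply: ticks_bound => // x xxs; case: eqP => [xn|_]; last exact: vxs.
  by rewrite -xn xxs in nxs.
have [] := ticks_trans (H (t n)) (@ticks_digits xs (updv v n (t n)) t U _ _).
- move=> x xxs; case: eqP => [xn|_]; last exact: vxs.
  by rewrite -xn xxs in nxs.
- by move=> x xxs; rewrite eqxx tn.
move=> m mE; exists m => x; rewrite mE inE => /orP[/eqP->|->//].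
by rewrite (negPf nxs) eqxx.
Qed.

End Odometer.

(** * Search loops on the machine *)

Section Search.
Variables (T : finType) (W A B C : T).
Hypothesis WABC : uniq [:: W; A; B; C].
Variables (tq ta : T) (O : bool -> nat -> word).

Local Notation runs := (runs tq ta O).
Local Notation compute := (compute W A B C).

Definition check (e : nexp T) (yes no : frag T) : frag T :=
  fseq (compute e) (fif W (fseq (take_nat W [::]) yes) (fseq (pop W) no)).

Definition idle (k : store T) : Prop :=
  [/\ k W = unary 0, k A = unary 0, k B = unary 0 & k C = unary 0].

Lemma runs_check v k e yes no k' : nreads W A B C v k e -> idle k ->
  runs (if (0 < neval v e)%N then yes else no) k k' ->
  runs (check e yes no) k k'.
Proof.
move=> ke [kW kA kB kC] H.
apply: runs_seq (runs_compute WABC tq ta O ke kW kA kB kC) _.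
have kE n : upd (pushed (upd k W n) [::] (neval v e)) W (Word [::]) = k.
  by apply/funext => z; rewrite /pushed /upd muln0 /=; case: eqP => // ->.
apply: runs_if; rewrite /upd eqxx /=; rewrite cats0.
case: posnP H => [E|Epos] H.
  rewrite E /=; apply: runs_seq (runs_pop _ _ _ (b := false) (w := [::]) _) _.
    by rewrite eqxx.
  suff -> : upd (fun y => if y == W then Word (code_nat 0) else k y)
    W (Word [::]) = k by [].
  by apply/funext => z; rewrite /upd; case: eqP => // ->.
have -> : ohead (code_nat (neval v e)) == Some true.
  by case: (neval v e) Epos.
apply: runs_seq.
  by apply: (@runs_take_nat _ _ _ _ _ _ _ (neval v e) [::]); rewrite ?eqxx ?cats0.
by rewrite kE.
Qed.

(** A loop can only test one head, so the flag [f] carries the condition and success is signalled by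
    popping it. *)
Definition search (f : T) (body : frag T) (e : nexp T) (next : frag T) : frag T :=
  fseq (push f true) (fwhile f (fseq body (check e (pop f) next))).

(** [Inv j] describes the stores at the start of round [j], [Mid j] those at its test. They are
    predicates because the contents of the answer tape need not be tracked. *)
Lemma runs_search f body e next (v : nat -> T -> nat)
    (Inv Mid : nat -> store T -> Prop) k m :
  k f = unary 0 -> Inv 0%N (upd k f (unary 1)) ->
  (forall j k, Inv j k -> k f = unary 1 /\ exists2 k', runs body k k' & Mid j k') ->
  (forall j k, Mid j k -> [/\ k f = unary 1, idle k & nreads W A B C (v j) k e]) ->
  (forall j k, Mid j k -> exists2 k', runs next k k' & Inv j.+1 k') ->
  (0 < neval (v m) e)%N -> (forall j, (j < m)%N -> neval (v j) e = 0%N) ->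
  exists2 k', Mid m k' & runs (search f body e next) k (upd k' f (unary 0)).
Proof.
move=> kf I0 Hbody Hmid Hnext mpos mmin.
suff loop d j k0 : (j + d)%N = m -> Inv j k0 -> exists2 k', Mid m k' &
      runs (fwhile f (fseq body (check e (pop f) next))) k0 (upd k' f (unary 0)).
  have [//|k' Mk' Hk'] := loop m 0%N _ _ I0; exists k' => //.
  by apply: runs_seq (runs_push tq ta O f true k) _; rewrite kf.
elim: d j {k kf I0} k0 => [|d IH] j k.
  rewrite addn0 => -> Im; have [kf [k1 bk Mk]] := Hbody _ _ Im.
  have [k1f k1i k1r] := Hmid _ _ Mk; exists k1 => //.
  apply: (@runs_whileS _ _ _ _ _ _ _ (upd k1 f (unary 0))); first by rewrite kf.
    apply: runs_seq bk _; apply: (runs_check k1r) => //; rewrite mpos.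
    exact: (@runs_pop _ _ _ _ _ _ true).
  by apply: runs_while0; rewrite /upd eqxx.
move=> jm Ij; have [kf [k1 bk Mk]] := Hbody _ _ Ij.
have [k1f k1i k1r] := Hmid _ _ Mk; have [k2 nk Ik2] := Hnext _ _ Mk.
have [|k' Mk' Hk'] := IH _ _ _ Ik2; first by rewrite addSn -addnS.
exists k' => //; apply: (@runs_whileS _ _ _ _ _ _ _ k2) => //; first by rewrite kf.
apply: runs_seq bk _; apply: (runs_check k1r) => //.
by rewrite mmin // -jm addnS ltnS leq_addr.
Qed.

Definition overlay (k : store T) (rs : seq T) (v : T -> nat) : store T :=
  fun z => if z \in rs then unary (v z) else k z.

(** The digit is incremented before it is compared: afterwards [x - n], truncated, is positive
    exactly if it has overflowed. *)
Fixpoint tick (n : T) (xs : seq T) : frag T :=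
  match xs with
  | [::] => push n true
  | x :: xs' => fseq (push x true) (check (NSub (NReg x) (NReg n))
      (fseq (drain x [::]) (tick n xs')) (skip T))
  end.

Lemma upd_overlay k rs v x a : x \in rs ->
  upd (overlay k rs v) x (unary a) =
  overlay k rs (fun y => if y == x then a else v y).
Proof.
by move=> xrs; apply/funext => z; rewrite /upd /overlay; case: eqP => // ->;
  rewrite xrs.
Qed.

Lemma runs_tick n xs k rs v :
  idle k -> uniq (n :: xs) -> {subset n :: xs <= rs} ->
  (forall x, x \in rs -> x \notin [:: W; A; B; C]) ->
  runs (tick n xs) (overlay k rs v) (overlay k rs (tickv n xs v)).
Proof.
move=> ki U sub disj; elim: xs v U sub => [|x xs IH] v U sub /=.
  have nrs : n \in rs by rewrite sub ?inE ?eqxx.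
  rewrite -upd_overlay //; apply: runs_eq; first exact: runs_push.
  by move=> z; rewrite {2}/overlay nrs.
have nrs : n \in rs by rewrite sub ?inE ?eqxx.
have xrs : x \in rs by rewrite sub ?inE ?eqxx ?orbT.
have xn : (n == x) = false.
  by move: U => /= /andP[]; rewrite inE negb_or => /andP[/negPf].
apply: runs_seq (runs_push _ _ _ _ _ _) _.
have -> : kpush true (overlay k rs v x) = unary (v x).+1 by rewrite /overlay xrs.
rewrite upd_overlay //; set v1 := (fun y => _).
apply: (@runs_check v1).
- by split; split; rewrite ?disj // /overlay ?xrs ?nrs.
- case: ki => *; have dj z : z \in [:: W; A; B; C] -> z \in rs = false.
    by move=> zW; apply/negP => /disj; rewrite zW.
  by split; rewrite /overlay dj // !inE eqxx ?orbT.
rewrite /= /v1 eqxx xn subn_gt0 ltnS leqNgt; case: ltnP => /= _.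
  exact: runs_skip.
apply: (@runs_seq _ _ _ _ _ _ _ (overlay k rs (fun y => if y == x then 0%N else v y))).
  apply: runs_eq.
    apply: (@runs_drain _ _ _ _ _ _ _ (v x).+1 [::]) => //.
    by rewrite /overlay xrs eqxx cats0.
  move=> z; rewrite /upd /pushed /overlay muln0 /=.
  by case: eqP => // ->; rewrite xrs.
apply: IH.
  by move: U; rewrite /= inE negb_or -!andbA => /and4P[_ -> _ ->].
by move=> z; rewrite inE => /orP[/eqP->//|zxs]; apply: sub; rewrite !inE zxs !orbT.
Qed.

End Search.

Local Open Scope ring_scope.

(** * Rational expressions *)

(** One syntax for two readings: [reval] serves the analysis over the reals, and [rcomp] compiles
    the same polynomial into the arithmetic of the machine. *)
Inductive rexp :=
  | RVar of nat
  | RCst of nat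
  | RAdd of rexp & rexp
  | RSub of rexp & rexp
  | RMul of rexp & rexp.

Fixpoint reval (K : realFieldType) (env : nat -> K) (e : rexp) : K :=
  match e with
  | RVar i => env i
  | RCst n => n%:R
  | RAdd e1 e2 => reval env e1 + reval env e2
  | RSub e1 e2 => reval env e1 - reval env e2
  | RMul e1 e2 => reval env e1 * reval env e2
  end.

(** The bounds on the values are carried through the induction for the sake of products, where each
    factor is multiplied by the variation of the other. *)
Lemma reval_lipschitz (K : realFieldType) (b : nat) (e : rexp) :
  exists L : nat, forall (x y : nat -> K) (eta : K), 0 <= eta ->
    (forall i, `|x i| <= b%:R) -> (forall i, `|y i| <= b%:R) ->
    (forall i, `|x i - y i| <= eta) ->
  [/\ `|reval x e| <= L%:R, `|reval y e| <= L%:R &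
      `|reval x e - reval y e| <= L%:R * eta].
Proof.
elim: e => [i|n|e1 [L1 I1] e2 [L2 I2]|e1 [L1 I1] e2 [L2 I2]|e1 [L1 I1] e2 [L2 I2]].
(* [b.+1] is both a bound on the values and at least the Lipschitz constant 1. *)
- exists b.+1 => x y eta eta0 xb yb xy /=.
  have bb : b%:R <= b.+1%:R :> K by rewrite ler_nat.
  split; [exact: le_trans bb|exact: le_trans bb|].
  by apply: (le_trans (xy i)); rewrite ler_peMl // ler1n.
- exists n => x y eta eta0 _ _ _ /=.
  by rewrite subrr normr0 !ger0_norm ?ler0n // mulr_ge0 ?ler0n.
- exists (L1 + L2)%N => x y eta eta0 xb yb xy /=; rewrite natrD mulrDl.
  have [a1 b1 c1] := I1 x y eta eta0 xb yb xy.
  have [a2 b2 c2] := I2 x y eta eta0 xb yb xy.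
  split; [exact: le_trans (ler_normD _ _) (lerD _ _)|
          exact: le_trans (ler_normD _ _) (lerD _ _)|].
  rewrite opprD addrACA; exact: le_trans (ler_normD _ _) (lerD _ _).
- exists (L1 + L2)%N => x y eta eta0 xb yb xy /=; rewrite natrD mulrDl.
  have [a1 b1 c1] := I1 x y eta eta0 xb yb xy.
  have [a2 b2 c2] := I2 x y eta eta0 xb yb xy.
  split; [exact: le_trans (ler_normB _ _) (lerD _ _)|
          exact: le_trans (ler_normB _ _) (lerD _ _)|].
  have -> : reval x e1 - reval x e2 - (reval y e1 - reval y e2) =
    (reval x e1 - reval y e1) - (reval x e2 - reval y e2) by ring.
  exact: le_trans (ler_normB _ _) (lerD _ _).
- exists (2 * L1 * L2)%N => x y eta eta0 xb yb xy /=.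
  have [a1 b1 c1] := I1 x y eta eta0 xb yb xy.
  have [a2 b2 c2] := I2 x y eta eta0 xb yb xy.
  have L12 : (L1 * L2)%:R <= (2 * L1 * L2)%:R :> K by rewrite ler_nat; lia.
  split.
  + by rewrite normrM; apply: le_trans L12; rewrite natrM ler_pM.
  + by rewrite normrM; apply: le_trans L12; rewrite natrM ler_pM.
  have -> : reval x e1 * reval x e2 - reval y e1 * reval y e2 =
    (reval x e1 - reval y e1) * reval x e2 +
    reval y e1 * (reval x e2 - reval y e2) by ring.
  apply: (le_trans (ler_normD _ _)); rewrite !normrM.
  have -> : (2 * L1 * L2)%:R * eta =
    L1%:R * eta * L2%:R + L1%:R * (L2%:R * eta) :> K by rewrite !natrM; ring.
  by rewrite lerD // ler_pM.
Qed.

(** * Compilation of polynomial inequalities to natural numbers *)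

Section Compile.
Variables (T : finType).

(* A triple [(p, n, d)] stands for the fraction (p - n) / d. *)
Definition frac : Type := (nexp T * nexp T * nexp T)%type.

Definition fracval (K : realFieldType) (v : T -> nat) (f : frac) : K :=
  ((neval v f.1.1)%:R - (neval v f.1.2)%:R) / (neval v f.2)%:R.

(** Positive and negative parts of the numerators are kept apart because subtraction in [nexp] is
    truncated. *)
Fixpoint rcomp (leaf : nat -> frac) (e : rexp) : frac :=
  match e with
  | RVar i => leaf i
  | RCst n => (NCst _ n, NCst _ 0, NCst _ 1)
  | RAdd e1 e2 => let: (p, n, d) := rcomp leaf e1 in
      let: (p', n', d') := rcomp leaf e2 in
      (NAdd (NMul p d') (NMul p' d), NAdd (NMul n d') (NMul n' d), NMul d d')
  | RSub e1 e2 => let: (p, n, d) := rcomp leaf e1 in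
      let: (p', n', d') := rcomp leaf e2 in
      (NAdd (NMul p d') (NMul n' d), NAdd (NMul n d') (NMul p' d), NMul d d')
  | RMul e1 e2 => let: (p, n, d) := rcomp leaf e1 in
      let: (p', n', d') := rcomp leaf e2 in
      (NAdd (NMul p p') (NMul n n'), NAdd (NMul p n') (NMul n p'), NMul d d')
  end.

Definition frac_denotes (K : realFieldType) (v : T -> nat) (f : frac) (x : K) :=
  (0 < neval v f.2)%N /\ fracval K v f = x.

Lemma rcompP (K : realFieldType) (v : T -> nat) leaf (env : nat -> K) e :
  (forall i, frac_denotes v (leaf i) (env i)) ->
  frac_denotes v (rcomp leaf e) (reval env e).
Proof.
move=> leafP; elim: e => [i|n|e1 I1 e2 I2|e1 I1 e2 I2|e1 I1 e2 I2] /=.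
- exact: leafP.
- by split; rewrite // /fracval /= subr0 divr1.
all: move: I1 I2; case: (rcomp leaf e1) (rcomp leaf e2) => [[p n] d] [[p' n'] d'].
all: rewrite /frac_denotes /fracval /= => -[d0 <-] [d0' <-].
all: split; first by rewrite muln_gt0 d0.
all: have {}d0 : (neval v d)%:R != 0 :> K by rewrite pnatr_eq0 -lt0n.
all: have {}d0' : (neval v d')%:R != 0 :> K by rewrite pnatr_eq0 -lt0n.
all: rewrite !natrD !natrM; field; by rewrite d0 d0'.
Qed.

(** A conjunction as a product: the truncated difference [p - n] is nonzero exactly if the fraction
    is positive, its denominator being positive. *)
Definition rtest (leaf : nat -> frac) (es : seq rexp) : nexp T :=
  foldr (fun e f => let: (p, n, _) := rcomp leaf e in NMul (NSub p n) f)
        (NCst T 1) es.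

Lemma rtestP (K : realFieldType) (v : T -> nat) leaf (env : nat -> K) es :
  (forall i, frac_denotes v (leaf i) (env i)) ->
  (0 < neval v (rtest leaf es))%N = all (fun e => 0 < reval env e) es.
Proof.
move=> leafP; elim: es => //= e es <-.
have := rcompP e leafP; case: (rcomp leaf e) => [[p n] d].
rewrite /frac_denotes /fracval /= => -[d0 <-].
rewrite muln_gt0 subn_gt0; congr (_ && _).
by rewrite pmulr_lgt0 ?invr_gt0 ?ltr0n // subr_gt0 ltr_nat.
Qed.

Definition frac_reads (W A B C : T) v k (f : frac) : Prop :=
  [/\ nreads W A B C v k f.1.1, nreads W A B C v k f.1.2 & nreads W A B C v k f.2].

Lemma frac_reads_rcomp (W A B C : T) v k leaf e :
  (forall i, frac_reads W A B C v k (leaf i)) ->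
  frac_reads W A B C v k (rcomp leaf e).
Proof.
move=> leafP; elim: e => [i|n|e1 I1 e2 I2|e1 I1 e2 I2|e1 I1 e2 I2] /=.
- exact: leafP.
- by split.
all: move: I1 I2; case: (rcomp leaf e1) (rcomp leaf e2) => [[? ?] ?] [[? ?] ?].
all: by case=> ? ? ? [? ? ?].
Qed.

Lemma nreads_rtest (W A B C : T) v k leaf es :
  (forall i, frac_reads W A B C v k (leaf i)) ->
  nreads W A B C v k (rtest leaf es).
Proof.
move=> leafP; elim: es => //= e es IH.
have := frac_reads_rcomp e leafP; case: (rcomp leaf e) => [[? ?] ?].
by case.
Qed.

End Compile.

(** * The strategy *)

Section Dynamics.
Local Open Scope classical_set_scope.
Variable K : realType.

(** If the series converged, its tail would be at most 1/2 from some index on; then [h] would keep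
    half of its value there, and every later delay would exceed a fixed positive number. *)
Lemma delays_diverge (h d : nat -> K) (N : nat) :
  0 <= h 0%N ->
  (forall i, 0 < d i <= 1) ->
  (forall i, h i < N%:R * d i) ->
  (forall i, h i * (1 - d i) < h i.+1) ->
  series d @ \oo --> +oo.
Proof.
move=> h0 d01 hN hS.
have h_ge0 i : 0 <= h i.
  elim: i => // i IH; apply: le_trans (ltW (hS i)).
  by rewrite mulr_ge0 // subr_ge0; case/andP: (d01 i).
(* Only from index 1 on: Evader may start on the boundary, where [h] is 0. *)
have h_gt0 i : 0 < h i.+1.
  apply: le_lt_trans (hS i); rewrite mulr_ge0 // subr_ge0.
  by case/andP: (d01 i).
have ser_nd : nondecreasing_seq (series d).
  apply/nondecreasing_seqP => n; rewrite [leRHS]seriesSr lerDl.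
  by case/andP: (d01 n) => /ltW.
apply: nondecreasing_dvgn_lt => // cv.
have ub := nondecreasing_cvgn_le ser_nd cv.
have [j _ Hj] : \forall n \near \oo, `|limn (series d) - series d n| < 2^-1.
  by apply: cvgr_dist_lt.
have {}Hj n : (j <= n)%N -> series d n - series d j.+1 <= 2^-1.
  move=> jn; have := Hj j.+1 (leqnSn j).
  by rewrite ltr_norml => /andP[_ Hj1]; have := ub n; lra.
(* The Weierstrass inequality: a product of factors [1 - d i] is at least 1 minus the sum of the
   [d i]. *)
have low n : h j.+1 * (1 - (series d (j.+1 + n)%N - series d j.+1)) <= h (j.+1 + n)%N.
  elim: n => [|n IH]; first by rewrite addn0 subrr subr0 mulr1.
  rewrite addnS; apply: le_trans (ltW (hS _)); rewrite seriesSr.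
  case/andP: (d01 (j.+1 + n)%N) => dn0 dn1.
  set S := series d (j.+1 + n)%N in IH *; set S0 := series d j.+1 in IH *.
  set dn := d _ in dn0 dn1 *; set hn := h (j.+1 + n)%N in IH *.
  have SS0 : S0 <= S by apply: ser_nd; rewrite leq_addr.
  have := h_gt0 j; set hj := h j.+1 in IH * => hj0.
  have : hj * (1 - (S - S0)) * (1 - dn) <= hn * (1 - dn) by rewrite ler_wpM2r // subr_ge0.
  have : 0 <= hj * ((S - S0) * dn) by rewrite !mulr_ge0 ?subr_ge0 // ltW.
  by lra.
have step n : h j.+1 / 2 <= N%:R * d (j.+1 + n)%N.
  apply: le_trans (ltW (hN _)); apply: le_trans (low n).
  rewrite ler_wpM2l ?(ltW (h_gt0 _)) //.
  by have := Hj (j.+1 + n)%N (leq_trans (leqnSn j) (leq_addr _ _)); lra.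
have grow n : n%:R * (h j.+1 / 2) <= N%:R * (series d (j.+1 + n)%N - series d j.+1).
  elim: n => [|n IH]; first by rewrite mul0r addn0 subrr mulr0.
  rewrite addnS seriesSr -natr1 mulrDl mul1r.
  by have := step n; lra.
(* With [m] times [h j.+1] above [N], the lower bound of [grow] exceeds [N / 2], which the tail
   forbids. *)
pose m := Num.bound (N%:R / (h j.+1)).
have : N%:R / h j.+1 < m%:R.
  by rewrite archi_boundP // divr_ge0 // ltW.
rewrite ltr_pdivrMr ?h_gt0 // => hm.
have := grow m; have := Hj (j.+1 + m)%N (leq_trans (leqnSn j) (leq_addr _ _)).
move=> s2 g; set s := _ - _ in s2 g; have : N%:R * s <= N%:R * 2^-1 by rewrite ler_wpM2l.
by lra.
Qed.

(* The gap between the players, as a function of time, dominates the concave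
   function [D + 2 s b - s^2 q], which is positive at both ends. *)
Lemma concave_gap (D b q t s : K) :
  0 < D -> 0 <= q -> 0 < D + 2 * t * b - t ^+ 2 * q -> 0 <= s <= t ->
  0 < D + 2 * s * b - s ^+ 2 * q.
Proof.
move=> D0 q0 gt0 /andP[s0 regs].
have [t0|tn0] := eqVneq t 0.
  have -> : s = 0 by apply/eqP; rewrite eq_le s0 andbT -t0.
  by lra.
have t0 : 0 < t by rewrite lt_def tn0 (le_trans s0).
have [->|sn0] := eqVneq s 0; first by lra.
have sp : 0 < s by rewrite lt_def sn0.
rewrite -(pmulr_rgt0 _ t0).
(* Interpolation along the chord from 0 to [t]; the last term is the surplus due to concavity. *)
have -> : t * (D + 2 * s * b - s ^+ 2 * q) =
  (t - s) * D + s * (D + 2 * t * b - t ^+ 2 * q) + t * s * q * (t - s) by ring.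
have : 0 < s * (D + 2 * t * b - t ^+ 2 * q) by rewrite mulr_gt0.
have : 0 <= (t - s) * D by rewrite mulr_ge0 ?subr_ge0 // ltW.
have : 0 <= t * s * q * (t - s) by rewrite !mulr_ge0 ?subr_ge0 // ltW.
by lra.
Qed.

End Dynamics.

(** * Existence of a move with room to spare *)

Section Moves.
Variable K : realType.

(* [vv] = |v|^2, [ev] = e.v, [wv] = (e - p).v, [D] = |e - p|^2,
   [h] = r^2 - |e|^2 and [d] is the delay. *)
Definition slack (N : nat) (vv ev wv D h d : K) : seq K :=
  [:: 1 - vv; 1 - d; h - 2 * ev - d * vv; N%:R * d - h;
      D + 2 * d * wv - d ^+ 2 * (1 - vv)].

(** The speed [1 - 3 mu] puts [1 - |v|^2] between [2 mu] and [6 mu]. The delay makes [N d - h] equal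
    to [h]; [4 h <= N] gives [d <= 1/2] and [N >= 8] gives [d <= h / 4], so that the third slack is
    at least [3 h / 4]. *)
Lemma tangent_slack (N : nat) (mu vv ev D h d : K) :
  (8 <= N)%N -> 4 * h <= N%:R -> 0 < mu -> 48 * mu <= 1 -> 10 * mu <= h ->
  5 * mu < D -> vv = (1 - 3 * mu) ^+ 2 -> ev <= 0 -> d = 2 * h / N%:R ->
  0 <= d <= 1 /\ all (fun x => 2 * mu < x) (slack N vv ev 0 D h d).
Proof.
move=> N8 hN mu0 mu1 muh muD -> ev0 dE.
have N8' : 8%:R <= N%:R :> K by rewrite ler_nat.
have N0 : 0 < N%:R :> K by lra.
have dN : N%:R * d = 2 * h by rewrite dE; field; lra.
have d0 : 0 <= d by rewrite dE divr_ge0 ?ler0n //; lra.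
have d12 : 2 * d <= 1.
  by rewrite dE mulrA ler_pdivrMr //; lra.
have d4h : 4 * d <= h.
  by rewrite dE mulrA ler_pdivrMr //; nra.
have mm : mu * mu <= mu by nra.
set q := (1 - 3 * mu) ^+ 2.
have qE : 1 - q = mu * (6 - 9 * mu) by rewrite /q; ring.
have q_lo : 2 * mu < 1 - q by rewrite qE; nra.
have q_hi : 1 - q <= 6 * mu by rewrite qE; nra.
have dq : d * q <= d by rewrite ler_piMr //; lra.
have d2 : d ^+ 2 <= 2^-1 ^+ 2 by rewrite ler_sqr ?nnegrE //; lra.
have ddq : d ^+ 2 * (1 - q) <= 2^-1 ^+ 2 * (6 * mu) by rewrite ler_pM ?sqr_ge0 //; lra.
by rewrite d0 /=; split; first lra; apply/and5P; split; lra.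
Qed.

(** The delay [12 mu] gives [N d >= 96 mu], well above [h]. The third slack is at least
    [rho - 12 mu], and [28 mu < r <= 2 rho] leaves [2 mu] of it. In the gap, [96 r mu] pays for the
    approach to Pursuer and [3 mu] for the quadratic term, whence [96 r + 5]. *)
Lemma inward_slack (N : nat) (r rho mu vv ev wv D h d : K) :
  (8 <= N)%N -> 0 < mu -> 48 * mu <= 1 -> 28 * mu < r -> h < 10 * mu -> 0 <= h ->
  (96 * r + 5) * mu < D -> vv = (1 - 3 * mu) ^+ 2 ->
  ev = - (1 - 3 * mu) * rho -> r <= 2 * rho -> - (4 * r) <= wv -> d = 12 * mu ->
  0 <= d <= 1 /\ all (fun x => 2 * mu < x) (slack N vv ev wv D h d).
Proof.
move=> N8 mu0 mu1 mur hmu h0 muD -> -> rrho wvr ->.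
have N8' : 8%:R <= N%:R :> K by rewrite ler_nat.
set q := (1 - 3 * mu) ^+ 2.
have qE : 1 - q = mu * (6 - 9 * mu) by rewrite /q; ring.
have q_lo : 2 * mu < 1 - q by rewrite qE; nra.
have q_hi : 1 - q <= 6 * mu by rewrite qE; nra.
have dq : 12 * mu * q <= 12 * mu by rewrite ler_piMr; lra.
have mN : 12 * mu * 8 <= N%:R * (12 * mu) by rewrite mulrC ler_pM2r; lra.
have rm : rho <= 2 * ((1 - 3 * mu) * rho) by nra.
have wm : - (96 * r * mu) <= 2 * (12 * mu) * wv.
  have : 24 * mu * - (4 * r) <= 24 * mu * wv by rewrite ler_pM2l //; lra.
  by lra.
have ddq : (12 * mu) ^+ 2 * (1 - q) <= 3 * mu.
  have : (12 * mu) ^+ 2 <= 2^-1 by nra.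
  have : 0 <= (12 * mu) ^+ 2 by rewrite sqr_ge0.
  by nra.
split; first lra.
by rewrite /=; apply/and5P; split; lra.
Qed.

(** The slack [2 mu] instead of 0 makes the move robust: with [mu] equal to [L] times the precision,
    an approximate move still passes a test on approximate data, as in [margin_complete]. *)
Lemma good_move (N : nat) (p1 p2 e1 e2 r mu : K) :
  (8 <= N)%N -> 4 * r ^+ 2 <= N%:R -> 0 < r ->
  p1 ^+ 2 + p2 ^+ 2 <= r ^+ 2 -> e1 ^+ 2 + e2 ^+ 2 <= r ^+ 2 ->
  0 < mu -> 48 * mu <= 1 -> 28 * mu < r -> 40 * mu <= r ^+ 2 ->
  (96 * r + 5) * mu < (e1 - p1) ^+ 2 + (e2 - p2) ^+ 2 ->
  exists v1 v2 d, [/\ v1 ^+ 2 + v2 ^+ 2 <= 1, 0 <= d <= 1 &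
    all (fun x => 2 * mu < x)
      (slack N (v1 ^+ 2 + v2 ^+ 2) (e1 * v1 + e2 * v2)
         ((e1 - p1) * v1 + (e2 - p2) * v2) ((e1 - p1) ^+ 2 + (e2 - p2) ^+ 2)
         (r ^+ 2 - (e1 ^+ 2 + e2 ^+ 2)) d)].
Proof.
move=> N8 rN r0 pr er mu0 mu48 mur mur2 muD.
set D := (e1 - p1) ^+ 2 + (e2 - p2) ^+ 2 in muD *.
set h := r ^+ 2 - (e1 ^+ 2 + e2 ^+ 2).
have h0 : 0 <= h by rewrite subr_ge0.
have la0 : 0 <= 1 - 3 * mu by lra.
have la1 : (1 - 3 * mu) ^+ 2 <= 1 by nra.
have [muh|hmu] := leP (10 * mu) h.
  have D0 : 0 < D by nra.
  pose s := Num.sqrt D.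
  have sD : s ^+ 2 = D by rewrite sqr_sqrtr // ltW.
  have s0 : 0 < s by rewrite sqrtr_gt0.
  (* The sign [t] selects, of the two directions orthogonal to [e - p], one that does not point away
     from the centre. *)
  have [t tt te] : exists2 t : K, t ^+ 2 = 1 &
      e1 * - (t * (e2 - p2)) + e2 * (t * (e1 - p1)) <= 0.
    have [H|H] := leP (e1 * - (e2 - p2) + e2 * (e1 - p1)) 0.
      by exists 1; [rewrite expr1n | rewrite !mul1r].
    by exists (-1); [rewrite sqrrN expr1n | lra].
  pose v1 := (1 - 3 * mu) * (- (t * (e2 - p2)) / s).
  pose v2 := (1 - 3 * mu) * (t * (e1 - p1) / s).
  have vvE : v1 ^+ 2 + v2 ^+ 2 = (1 - 3 * mu) ^+ 2.
    rewrite /v1 /v2 ![((1 - 3 * mu) * _) ^+ 2]exprMn !exprMn -mulrDr.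
    rewrite sqrrN !exprMn tt !mul1r exprVn sD -mulrDl [X in X / D]addrC divff ?mulr1 //.
    by rewrite gt_eqF.
  have wvE : (e1 - p1) * v1 + (e2 - p2) * v2 = 0 by rewrite /v1 /v2; ring.
  have evE : e1 * v1 + e2 * v2 <= 0.
    have -> : e1 * v1 + e2 * v2 = (1 - 3 * mu) *
      ((e1 * - (t * (e2 - p2)) + e2 * (t * (e1 - p1))) / s).
      by rewrite /v1 /v2; ring.
    by rewrite mulr_ge0_le0 // mulr_le0_ge0 // invr_ge0 ltW.
  exists v1, v2, (2 * h / N%:R); rewrite wvE.
  have [||d01 sl] := @tangent_slack N mu (v1 ^+ 2 + v2 ^+ 2) (e1 * v1 + e2 * v2)
    D h (2 * h / N%:R) N8 _ mu0 mu48 muh _ vvE evE erefl.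
  - by rewrite /h; nra.
  - by nra.
  by split; rewrite // vvE.
pose rho := Num.sqrt (e1 ^+ 2 + e2 ^+ 2).
have rhoE : rho ^+ 2 = e1 ^+ 2 + e2 ^+ 2 by rewrite sqr_sqrtr // addr_ge0 ?sqr_ge0.
have rho_ge0 : 0 <= rho by exact: sqrtr_ge0.
(* [h < 10 mu] and [40 mu <= r^2] give [|e|^2 > 3 r^2 / 4], so the direction to the centre is well
   defined. *)
have rrho : r <= 2 * rho by rewrite /h in hmu; nra.
have rho0 : 0 < rho by lra.
have rhor : rho <= r by nra.
pose v1 := - (1 - 3 * mu) * (e1 / rho).
pose v2 := - (1 - 3 * mu) * (e2 / rho).
have ee : (e1 / rho) ^+ 2 + (e2 / rho) ^+ 2 = 1.
  by rewrite !exprMn exprVn rhoE -mulrDl divff // -rhoE gt_eqF // exprn_gt0.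
have vvE : v1 ^+ 2 + v2 ^+ 2 = (1 - 3 * mu) ^+ 2.
  by rewrite /v1 /v2 ![(- _ * _) ^+ 2]exprMn sqrrN -mulrDr ee mulr1.
have evE : e1 * v1 + e2 * v2 = - (1 - 3 * mu) * rho.
  have -> : e1 * v1 + e2 * v2 = - (1 - 3 * mu) * ((e1 ^+ 2 + e2 ^+ 2) / rho).
    by rewrite /v1 /v2; ring.
  by rewrite -rhoE expr2 mulfK // gt_eqF.
(* Crude: coordinates of [e - p] are at most [2 r] in absolute value, those of [v] at most 1. *)
have wvE : - (4 * r) <= (e1 - p1) * v1 + (e2 - p2) * v2.
  have v1b : -1 <= v1 <= 1 by nra.
  have v2b : -1 <= v2 <= 1 by nra.
  have : -r <= e1 <= r by nra.
  have : -r <= e2 <= r by nra.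
  have : -r <= p1 <= r by nra.
  have : -r <= p2 <= r by nra.
  by nra.
exists v1, v2, (12 * mu).
have [d01 sl] := @inward_slack N r rho mu _ _ _ D h (12 * mu) N8 mu0 mu48 mur hmu h0
  muD vvE evE rrho wvE erefl.
by split; rewrite // vvE.
Qed.

End Moves.

Section Strategy.
Variable K : realType.

(** This fixes the numbering of the variables of all the polynomials below; slot 8, the precision,
    occurs only in [margin]. *)
Definition point (p e v : 'rV[K]_2) (r d eps : K) : nat -> K :=
  nth 0 [:: p 0 0; p 0 1; e 0 0; e 0 1; r; v 0 0; v 0 1; d; eps].

Definition rdot (a b c d : rexp) : rexp := RAdd (RMul a b) (RMul c d).

Definition dist_exp : rexp :=
  let x := RSub (RVar 2) (RVar 0) in let y := RSub (RVar 3) (RVar 1) in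
  rdot x x y y.

(** The third polynomial is [(h' - (1 - d) h) / d], where [h'] is the value of [h] after the move;
    the last is [|e + d v - p|^2 - d^2]. *)
Definition slack_exps (N : nat) : seq rexp :=
  let x := RSub (RVar 2) (RVar 0) in let y := RSub (RVar 3) (RVar 1) in
  let d := RVar 7 in
  let vv := rdot (RVar 5) (RVar 5) (RVar 6) (RVar 6) in
  let ev := rdot (RVar 2) (RVar 5) (RVar 3) (RVar 6) in
  let wv := rdot x (RVar 5) y (RVar 6) in
  let h := RSub (RMul (RVar 4) (RVar 4))
                (rdot (RVar 2) (RVar 2) (RVar 3) (RVar 3)) in
  [:: RSub (RCst 1) vv; RSub (RCst 1) d;
      RSub (RSub h (RMul (RCst 2) ev)) (RMul d vv);
      RSub (RMul (RCst N) d) h;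
      RSub (RAdd dist_exp (RMul (RMul (RCst 2) d) wv))
           (RMul (RMul d d) (RSub (RCst 1) vv))].

Lemma slack_expsE N (x : nat -> K) :
  [seq reval x g | g <- slack_exps N] =
  slack N (x 5%N ^+ 2 + x 6%N ^+ 2) (x 2%N * x 5%N + x 3%N * x 6%N)
    ((x 2%N - x 0%N) * x 5%N + (x 3%N - x 1%N) * x 6%N)
    ((x 2%N - x 0%N) ^+ 2 + (x 3%N - x 1%N) ^+ 2)
    (x 4%N ^+ 2 - (x 2%N ^+ 2 + x 3%N ^+ 2)) (x 7%N).
Proof. by rewrite /slack !expr2. Qed.

Definition evade (r : K) (N : nat) : strategy K := fun _ p e a =>
  0 < a.2 /\ all (fun g => 0 < reval (point p e a.1 r a.2 0) g) (slack_exps N).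

Lemma evadeP r N i p e a : evade r N i p e a ->
  [/\ 0 < a.2, a.2 < 1, a.1 0 0 ^+ 2 + a.1 0 1 ^+ 2 < 1 &
   [/\ 2 * (e 0 0 * a.1 0 0 + e 0 1 * a.1 0 1) +
      a.2 * (a.1 0 0 ^+ 2 + a.1 0 1 ^+ 2) < r ^+ 2 - (e 0 0 ^+ 2 + e 0 1 ^+ 2),
     r ^+ 2 - (e 0 0 ^+ 2 + e 0 1 ^+ 2) < N%:R * a.2 &
     0 < (e 0 0 - p 0 0) ^+ 2 + (e 0 1 - p 0 1) ^+ 2 +
      2 * a.2 * ((e 0 0 - p 0 0) * a.1 0 0 + (e 0 1 - p 0 1) * a.1 0 1) -
      a.2 ^+ 2 * (1 - (a.1 0 0 ^+ 2 + a.1 0 1 ^+ 2))]].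
Proof.
case=> a0; rewrite -(all_map (reval _) (fun x => 0 < x)) slack_expsE /point /= andbT.
by case/and5P => ? ? ? ? ?; do ![split=> //]; lra.
Qed.

Lemma enorm2E (x : 'rV[K]_2) : enorm x = Num.sqrt (x 0 0 ^+ 2 + x 0 1 ^+ 2).
Proof.
rewrite /enorm !big_ord_recl big_ord0 addr0.
by have -> : lift ord0 ord0 = 1 :> 'I_2 by apply/val_inj.
Qed.

Lemma enorm2_le (x : 'rV[K]_2) c : 0 <= c ->
  (enorm x <= c) = (x 0 0 ^+ 2 + x 0 1 ^+ 2 <= c ^+ 2).
Proof.
move=> c0; rewrite enorm2E -[X in _ <= X]ger0_norm // -sqrtr_sqr.
by rewrite ler_sqrt // sqr_ge0.
Qed.

Lemma rV2_neq (x y : 'rV[K]_2) : x != y ->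
  0 < (y 0 0 - x 0 0) ^+ 2 + (y 0 1 - x 0 1) ^+ 2.
Proof.
move=> xy; rewrite lt_def addr_ge0 ?sqr_ge0 // andbT.
apply: contra xy; rewrite paddr_eq0 ?sqr_ge0 // !sqrf_eq0 !subr_eq0.
case/andP => /eqP e0 /eqP e1; apply/eqP/rowP => j.
case: (splitP (j : 'I_(1 + 1))) => k jk.
  by have -> : j = 0 by apply/val_inj; rewrite /= jk ord1.
by have -> : j = 1 by apply/val_inj; rewrite /= jk ord1.
Qed.

(** Along the segment [|e|^2] grows by [s (2 e.v + s |v|^2)]. This is nonpositive, or, as
    [s <= d < 1], at most [2 e.v + d |v|^2], which is below [h]. *)
Lemma evade_admissible r N : 0 <= r -> piecewise_blind r (evade r N).
Proof.
move=> r0 i p e _ eD _ [v d] /evadeP /= [d0 d1 v1 [h1 _ _]]; split=> /=.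
- by rewrite enorm2_le // expr1n ltW.
- by [].
move=> s /andP[s0 sd]; rewrite /disk /= enorm2_le // !mxE.
move: eD; rewrite /disk /= enorm2_le // => eD.
set vv := v 0 0 ^+ 2 + _ in v1 h1; set ev := e 0 0 * _ + _ in h1.
have vv0 : 0 <= vv by rewrite addr_ge0 ?sqr_ge0.
have -> : (e 0 0 + s * v 0 0) ^+ 2 + (e 0 1 + s * v 0 1) ^+ 2 =
  e 0 0 ^+ 2 + e 0 1 ^+ 2 + s * (2 * ev + s * vv) by rewrite /ev /vv; ring.
have svv : s * vv <= d * vv by rewrite ler_wpM2r.
have [X0|X0] := leP (2 * ev + s * vv) 0.
  by have := mulr_ge0_le0 s0 X0; lra.
have : s * (2 * ev + s * vv) <= 2 * ev + s * vv by rewrite ler_piMl //; lra.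
by lra.
Qed.

Lemma evader_atS e0 (a : nat -> 'rV[K]_2 * K) n :
  evader_at e0 a n.+1 = evader_at e0 a n + (a n).2 *: (a n).1.
Proof. by rewrite /evader_at big_nat_recr //= addrA. Qed.

Lemma evade_winning r N : 0 <= r -> winning r (evade r N).
Proof.
move=> r0 p0 e0 p0D e0D pe0 P a [PD Plip] P0.
pose h n := r ^+ 2 - (evader_at e0 a n 0 0 ^+ 2 + evader_at e0 a n 0 1 ^+ 2).
have h0 : 0 <= h 0%N.
  by rewrite /h /evader_at big_geq // addr0 subr_ge0 -enorm2_le.
have hS n : consistent (evade r N) P e0 a n -> h n * (1 - (a n).2) < h n.+1.
  move=> cn; have [d0 d1 v1 [h1 _ _]] := evadeP (i := n) cn.
  rewrite /h evader_atS; move: (evader_at e0 a n) h1 => en h1; rewrite !mxE.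
  set x := en 0 0 in h1 *; set y := en 0 1 in h1 *; set d := (a n).2 in d0 d1 h1 *.
  set v := (a n).1 0 0 in v1 h1 *; set w := (a n).1 0 1 in v1 h1 *.
  rewrite -subr_gt0.
  have -> : r ^+ 2 - ((x + d * v) ^+ 2 + (y + d * w) ^+ 2) -
     (r ^+ 2 - (x ^+ 2 + y ^+ 2)) * (1 - d) =
     d * (r ^+ 2 - (x ^+ 2 + y ^+ 2) - (2 * (x * v + y * w) +
        d * (v ^+ 2 + w ^+ 2))) by ring.
  by rewrite mulr_gt0 // subr_gt0.
split; last first.
  move=> cons; apply: (@delays_diverge K h (fun i => (a i).2) N) => //.
  - by move=> i; have [-> /ltW->] := evadeP (i := i) (cons i).
  - by move=> i; have [_ _ _ [_ ? _]] := evadeP (i := i) (cons i).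
  - by move=> i; apply: hS.
(* A capture [s] after the start of the step would put [e + s v] within distance [s] of [p], against
   [concave_gap]. *)
have apart n : P (step_time a n) != evader_at e0 a n ->
    0 <= step_time a n -> consistent (evade r N) P e0 a n ->
    forall s, 0 <= s <= (a n).2 ->
    P (step_time a n + s) != evader_at e0 a n + s *: (a n).1.
  move=> sep tn cn s sd; apply/negP => /eqP Pe.
  have [d0 d1 v1 [_ _ gap]] := evadeP (i := n) cn.
  case/andP: (sd) => s0 _.
  have := Plip (step_time a n) (step_time a n + s) tn.
  rewrite lerDl => /(_ s0); rewrite addrAC subrr add0r Pe.
  have := concave_gap (rV2_neq sep) _ gap sd.
  rewrite subr_ge0 => /(_ (ltW v1)).
  move: (evader_at e0 a n) (P _) (a n).1 => en pn v.
  by rewrite enorm2_le // !mxE; lra.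
(* Concavity needs distinct positions when the step starts; they come from [apart] at the end of the
   preceding step. *)
have invs n : (forall i, (i < n)%N -> consistent (evade r N) P e0 a i) ->
    P (step_time a n) != evader_at e0 a n /\ 0 <= step_time a n.
  elim: n => [|n IH] cons.
    by rewrite /step_time /series /= big_geq // P0 /evader_at big_geq // addr0.
  have [i ni|sep tn] := IH; first by apply: cons; apply: ltnW.
  have cn : consistent (evade r N) P e0 a n by apply: cons.
  have [d0 _ _ _] := evadeP (i := n) cn.
  rewrite /step_time seriesSr; split; last by rewrite addr_ge0 // ltW.
  by rewrite evader_atS; apply: apart => //; rewrite lexx ltW.
move=> n cons; have [i ni|sep tn] := invs n; first by apply: cons; apply: ltnW.
by apply: apart => //; apply: cons.
Qed.

End Strategy.

(** * The decidable tests *)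

Section Margin.
Variable K : realType.

(** Reduced by the largest error that the precision in slot 8 can cause, [g] can be tested on
    approximations. *)
Definition margin (L : nat) (g : rexp) : rexp := RSub g (RMul (RCst L) (RVar 8)).

Definition lipschitz_on (b L : nat) (es : seq rexp) : Prop :=
  forall i (x y : nat -> K) (eta : K), 0 <= eta ->
    (forall i, `|x i| <= b%:R) -> (forall i, `|y i| <= b%:R) ->
    (forall i, `|x i - y i| <= eta) ->
  `|reval x (nth (RCst 0) es i) - reval y (nth (RCst 0) es i)| <= L%:R * eta.

Lemma lipschitz_on_exists (b : nat) (es : seq rexp) :
  exists2 L : nat, (0 < L)%N & lipschitz_on b L es.
Proof.
elim: es => [|g es [L2 L20 IH]].
  exists 1%N => // i x y eta eta0 _ _ _; rewrite nth_nil /= subrr normr0.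
  by rewrite mul1r.
have [L1 I1] := reval_lipschitz K b g.
exists (L1 + L2)%N; first by rewrite addn_gt0 L20 orbT.
move=> i x y eta eta0 xb yb xy; rewrite natrD mulrDl; case: i => [|i] /=.
  have [_ _ H] := I1 x y eta eta0 xb yb xy.
  by apply: (le_trans H); rewrite lerDl mulr_ge0.
by apply: (le_trans (IH i x y eta eta0 xb yb xy)); rewrite lerDr mulr_ge0.
Qed.

Lemma margin_sound b L es (x y : nat -> K) :
  lipschitz_on b L es ->
  (forall i, `|x i| <= b%:R) -> (forall i, `|y i| <= b%:R) ->
  (forall i, `|x i - y i| <= y 8%N) ->
  all (fun g => 0 < reval y (margin L g)) es ->
  all (fun g => 0 < reval x g) es.
Proof.
move=> lip xb yb xy /(all_nthP (RCst 0)) H; apply/(all_nthP (RCst 0)) => i ies.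
have eta0 : 0 <= y 8%N by apply: le_trans (xy 0%N).
have := lip i x y _ eta0 xb yb xy; have := H i ies; rewrite /margin /=.
by rewrite ler_norml => ? /andP[? _]; lra.
Qed.

(** One [L] times the precision is lost in passing to the approximation, the other is subtracted by
    [margin]. *)
Lemma margin_complete b L es (x y : nat -> K) :
  lipschitz_on b L es ->
  (forall i, `|x i| <= b%:R) -> (forall i, `|y i| <= b%:R) ->
  (forall i, `|x i - y i| <= y 8%N) ->
  all (fun g => 2 * (L%:R * y 8%N) < reval x g) es ->
  all (fun g => 0 < reval y (margin L g)) es.
Proof.
move=> lip xb yb xy /(all_nthP (RCst 0)) H; apply/(all_nthP (RCst 0)) => i ies.
have eta0 : 0 <= y 8%N by apply: le_trans (xy 0%N).
have := lip i x y _ eta0 xb yb xy; have := H i ies; rewrite /margin /=.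
by rewrite ler_norml => ? /andP[_ ?]; lra.
Qed.

End Margin.

(* Dense rationals in lowest terms by construction, as [code_rat] requires. *)
Definition candq (s a n : nat) : rat :=
  (if s == 0%N then 1 else -1) * ((a * n.+1 + 1)%:R / (n.+1 * n.+1)%:R).

(** The numerator is 1 modulo [n.+1]. *)
Lemma coprime_cand a n : coprime (a * n.+1 + 1) (n.+1 * n.+1).
Proof. by rewrite coprimeMr andbb coprime_sym /coprime gcdnMDl gcdn1. Qed.

Lemma code_candq s a n :
  code_rat (candq s a n) =
  (s != 0%N) :: code_nat (a * n.+1 + 1) ++ code_nat (n.+1 * n.+1).
Proof.
pose sg : int := if s == 0%N then 1 else -1.
have candE : candq s a n = (sg * (a * n.+1 + 1)%:Z)%:~R / ((n.+1 * n.+1)%:Z)%:~R.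
  by rewrite /candq /sg intrM -mulrA; case: eqP.
have cop : coprime (absz (sg * (a * n.+1 + 1)%:Z)) (absz (n.+1 * n.+1)%:Z).
  have sg1 : absz sg = 1%N by rewrite /sg; case: eqP.
  by rewrite abszM sg1 mul1n coprime_cand.
rewrite /code_rat candE coprimeq_num // coprimeq_den //.
rewrite gtr0_sg // mul1r /code_nats /= cats0 /sg.
by case: eqP => _; rewrite ?mulN1r ?mul1r ?abszN ?oppr_lt0 //= addn1.
Qed.

Lemma ratr_candq (K : realFieldType) s a n :
  ratr (candq s a n) = (if s == 0%N then 1 else -1) *
   ((a * n.+1 + 1)%:R / (n.+1 * n.+1)%:R) :> K.
Proof.
rewrite /candq rmorphM fmorph_div /= !ratr_nat.
by case: eqP; rewrite ?rmorphN1 ?rmorph1.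
Qed.

(** Take for [a] the integer part of [|t| n]; the error is at most [2 / (n + 1)], and [a <= n] keeps
    the candidate within 1. All large [n] are allowed because the three numbers of a move share one
    [n]. *)
Lemma candq_near (K : realType) (t eps : K) : -1 <= t <= 1 -> 0 < eps ->
  exists n0, forall n, (n0 <= n)%N -> exists2 a, (a <= n)%N &
    `|t - ratr (candq (t < 0)%R a n)| <= eps /\
    `|ratr (candq (t < 0)%R a n)| <= 1 :> K.
Proof.
move=> /andP[t1 t2] eps0.
have : 2 / eps < (Num.bound (2 / eps))%:R by rewrite archi_boundP // divr_ge0 // ltW.
rewrite ltr_pdivrMr // => bE.
exists (Num.bound (2 / eps)) => n hn.
have tn0 : 0 <= `|t| * n%:R by rewrite mulr_ge0.
have t_le1 : `|t| <= 1 by rewrite ler_norml t1 t2.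
have /andP[a1 a2] := trunc_itv tn0.
set a := Num.trunc (`|t| * n%:R) in a1 a2 *.
have an : (a <= n)%N.
  by rewrite -(ler_nat K); apply: (le_trans a1); rewrite ler_piMl.
exists a => //.
have m0 : 0 < n.+1%:R :> K by rewrite ltr0n.
set m : K := n.+1%:R in m0 *.
have nE : n%:R = m - 1 :> K by rewrite /m -natr1 addrK.
set c : K := (a * n.+1 + 1)%:R / (n.+1 * n.+1)%:R.
have cE : c = (a%:R + m^-1) / m.
  by rewrite /c natrD !natrM -/m; field; rewrite gt_eqF.
have mi : 0 < m^-1 by rewrite invr_gt0.
have mi1 : m^-1 <= 1 by rewrite invf_le1 // /m ler1n.
have am : a%:R <= m - 1 by rewrite -nE ler_nat.
have c0 : 0 <= c by rewrite cE divr_ge0 // ltW // ltr_wpDl.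
have c1 : c <= 1 by rewrite cE ler_pdivrMr // mul1r (le_trans (lerD am mi1)) // subrK.
have tc : `| `|t| - c| <= eps.
  have nm : (Num.bound (2 / eps))%:R * eps <= m * eps.
    by rewrite ler_pM2r // /m ler_nat ltnW.
  have -> : `|t| - c = (`|t| * m - a%:R - m^-1) / m.
    by rewrite cE; field; rewrite gt_eqF.
  rewrite normrM (gtr0_norm mi) ler_pdivrMr // [eps * m]mulrC.
  rewrite -natr1 in a2; rewrite nE in a1 a2.
  have u0 := normr_ge0 t; move: mi mi1 => {cE}; move: (m^-1) => q q0 q1.
  by rewrite ler_norml; apply/andP; split; lra.
rewrite ratr_candq -/c; case: ltP => t0 /=.
  rewrite mulN1r opprK normrN [`|c|]ger0_norm //; split=> //.
  by move: tc; rewrite (ltr0_norm t0) -normrN opprD !opprK.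
by rewrite mul1r [`|c|]ger0_norm //; move: tc; rewrite (ger0_norm t0).
Qed.

(** * From real moves to rational candidates *)

Section Tests.
Variable K : realType.

Lemma coord_le_enorm (x : 'rV[K]_2) : `|x 0 0| <= enorm x /\ `|x 0 1| <= enorm x.
Proof.
rewrite enorm2E; split; rewrite -sqrtr_sqr ler_sqrt ?addr_ge0 ?sqr_ge0 //.
  by rewrite lerDl sqr_ge0.
by rewrite lerDr sqr_ge0.
Qed.

Lemma point_near (p p' e e' v v' : 'rV[K]_2) (r r' d d' eps eta : K) :
  enorm (p - p') <= eta -> enorm (e - e') <= eta -> `|r - r'| <= eta ->
  `|v 0 0 - v' 0 0| <= eta -> `|v 0 1 - v' 0 1| <= eta -> `|d - d'| <= eta ->
  forall i, `|point p e v r d eps i - point p' e' v' r' d' eps i| <= eta.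
Proof.
move=> pp ee rr v0 v1 dd i.
have [p0 p1] := coord_le_enorm (p - p'); have [e0 e1] := coord_le_enorm (e - e').
rewrite !mxE in p0 p1 e0 e1.
have eta0 : 0 <= eta by apply: le_trans rr.
rewrite /point; do 9?[case: i => [|i] /=]; rewrite ?subrr ?normr0 //.
all: try by [exact: le_trans pp|exact: le_trans ee].
Qed.

Lemma point_bounded (p e v : 'rV[K]_2) (r d eps b : K) :
  enorm p <= b -> enorm e <= b -> `|r| <= b -> `|v 0 0| <= b -> `|v 0 1| <= b ->
  `|d| <= b -> `|eps| <= b -> forall i, `|point p e v r d eps i| <= b.
Proof.
move=> pb eb rb v0 v1 db epsb i.
have [p0 p1] := coord_le_enorm p; have [e0 e1] := coord_le_enorm e.
rewrite /point; do 9?[case: i => [|i] /=] => //.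
all: try by [exact: le_trans pb|exact: le_trans eb].
by rewrite nth_nil normr0; apply: le_trans rb.
Qed.

(** With [z = x - y], Cauchy-Schwarz in the form [- x.z <= r c] results from expanding
    [|r z + c x|^2 >= 0] and dividing by [r c], which is why zero radii are treated apart. *)
Lemma enorm_triangle2 (x y : 'rV[K]_2) (r c : K) : 0 <= r ->
  enorm x <= r -> enorm (x - y) <= c -> enorm y <= r + c.
Proof.
move=> r0; have c0 : enorm (x - y) <= c -> 0 <= c.
  by apply: le_trans; rewrite enorm2E sqrtr_ge0.
move=> xr xyc; have {}c0 := c0 xyc; move: xr xyc.
rewrite !enorm2_le ?addr_ge0 // !mxE.
set a := x 0 0; set a' := x 0 1; set u := y 0 0; set u' := y 0 1 => H1 H2.
have : 0 <= (r * (a - u) + c * a) ^+ 2 by rewrite sqr_ge0.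
have : 0 <= (r * (a' - u') + c * a') ^+ 2 by rewrite sqr_ge0.
have zero (z t : K) : z ^+ 2 + t ^+ 2 <= 0 ^+ 2 -> z = 0 /\ t = 0.
  rewrite expr0n /= => zt; have := sqr_ge0 z; have := sqr_ge0 t => t2 z2.
  by split; apply/eqP; rewrite -sqrf_eq0 eq_le sqr_ge0 andbT; lra.
have [rE|rn0] := eqVneq r 0.
  by move: H1 H2; rewrite rE add0r => /zero[-> ->]; rewrite !sub0r !sqrrN.
have [cE|cn0] := eqVneq c 0.
  by move: H2 H1; rewrite cE addr0 => /zero[/subr0_eq-> /subr0_eq->].
have rp : 0 < r by rewrite lt_def rn0.
have cp : 0 < c by rewrite lt_def cn0.
move=> I1 I2; have cs : - (a * (a - u) + a' * (a' - u')) <= r * c.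
  rewrite -(ler_pM2l (mulr_gt0 rp cp)).
  have : c ^+ 2 * (a ^+ 2 + a' ^+ 2) <= c ^+ 2 * r ^+ 2 by rewrite ler_wpM2l ?sqr_ge0.
  have : r ^+ 2 * ((a - u) ^+ 2 + (a' - u') ^+ 2) <= r ^+ 2 * c ^+ 2.
    by rewrite ler_wpM2l ?sqr_ge0.
  by lra.
by lra.
Qed.

Definition cvec (s1 a1 s2 a2 n : nat) : 'rV[rat]_2 :=
  \row_j (if j == 0 then candq s1 a1 n else candq s2 a2 n).

Lemma reval_dist (x : nat -> K) :
  reval x dist_exp = (x 2%N - x 0%N) ^+ 2 + (x 3%N - x 1%N) ^+ 2.
Proof. by rewrite !expr2. Qed.

Lemma reval_margin (x : nat -> K) L g :
  reval x (margin L g) = reval x g - L%:R * x 8%N.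
Proof. by []. Qed.

(** A single hypothesis bounds [mu] in every way required: all terms are compared with [b^2 mu], as
    [b >= 1], and [D <= 8 r^2] turns smallness against [D] into smallness against [r]. *)
Lemma small_margin (r b mu D : K) :
  0 < r -> r + 2 <= b -> 0 < mu -> 1100 * b ^+ 2 * mu < D -> D <= 8 * r ^+ 2 ->
  [/\ 48 * mu <= 1, 28 * mu < r, 40 * mu <= r ^+ 2 & (96 * r + 5) * mu < D].
Proof.
move=> r0 rb mu0 muD Dr.
have bp : 0 < b by lra.
have b2p : 0 < b ^+ 2 by rewrite exprn_gt0.
have rlb : r <= b by lra.
have rrb : r ^+ 2 <= b ^+ 2 by rewrite ler_sqr ?nnegrE // ltW.
have bb : b <= b ^+ 2 by rewrite expr2 ler_peMl; lra.
have bmu : b * mu <= b ^+ 2 * mu by rewrite ler_pM2r.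
have rmu : r * mu <= b * mu by rewrite ler_pM2r.
have mub : mu <= b * mu by rewrite ler_peMl ?ltW //; lra.
split.
- by rewrite -(ler_pM2l b2p) mulr1; lra.
- by rewrite -(ltr_pM2l r0) -expr2; lra.
- by lra.
- by lra.
Qed.

Lemma dist_disk_le (r : K) (p e : 'rV[K]_2) : disk r p -> disk r e ->
  (e 0 0 - p 0 0) ^+ 2 + (e 0 1 - p 0 1) ^+ 2 <= 8 * r ^+ 2.
Proof.
rewrite /disk /= => pD eD.
have r0 : 0 <= r by apply: le_trans pD; rewrite enorm2E sqrtr_ge0.
move: pD eD; rewrite !enorm2_le //.
set a := e 0 0; set b := e 0 1; set c := p 0 0; set d := p 0 1 => H1 H2.
have := sqr_ge0 (a + c); have := sqr_ge0 (b + d); have := sqr_ge0 r.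
by lra.
Qed.

Lemma dist_margin (r rt eps b : K) (L C : nat) (p e pt et : 'rV[K]_2) :
  (forall x y : nat -> K, (forall i, `|x i| <= b) -> (forall i, `|y i| <= b) ->
     (forall i, `|x i - y i| <= eps) ->
     `|reval x dist_exp - reval y dist_exp| <= L%:R * eps) ->
  0 <= eps -> eps <= b -> `|r| <= b -> `|rt| <= b ->
  enorm p <= b -> enorm e <= b -> enorm pt <= b -> enorm et <= b ->
  enorm (p - pt) <= eps -> enorm (e - et) <= eps -> `|r - rt| <= eps ->
  0 < reval (point pt et 0 rt 0 eps) (margin (C + L) dist_exp) ->
  C%:R * eps < (e 0 0 - p 0 0) ^+ 2 + (e 0 1 - p 0 1) ^+ 2.
Proof.
move=> lip eps0 epsb rb rtb pb eb ptb etb pp ee rr.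
have b0 : 0 <= b by exact: le_trans epsb.
have zb : `|(0 : K)| <= b by rewrite normr0.
have z0 j : `|(0 : 'rV[K]_2) 0 j| <= b by rewrite mxE normr0.
have z' j : `|(0 : 'rV[K]_2) 0 j - (0 : 'rV[K]_2) 0 j| <= eps by rewrite subrr normr0.
have z : `|(0 : K) - 0| <= eps by rewrite subrr normr0.
have eb' : `|eps| <= b by rewrite ger0_norm.
have := lip (point p e 0 r 0 eps) (point pt et 0 rt 0 eps)
  (point_bounded pb eb rb (z0 0) (z0 1) zb eb')
  (point_bounded ptb etb rtb (z0 0) (z0 1) zb eb')
  (point_near eps pp ee rr (z' 0) (z' 1) z).
rewrite reval_margin !reval_dist ler_norml natrD /point /= => /andP[H _] H1.
by clear -H H1; lra.
Qed.

Lemma approx_bounded (r b eps : K) (x y : 'rV[K]_2) :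
  0 < r -> r + 2 <= b -> disk r x -> enorm (x - y) <= eps -> eps <= 1 ->
  enorm x <= b /\ enorm y <= b.
Proof.
move=> r0 rb xD xy e1; split; first by apply: le_trans xD _; lra.
by apply: le_trans (enorm_triangle2 (ltW r0) xD xy) _; lra.
Qed.

Lemma sqr_le1 (x : K) : x ^+ 2 <= 1 -> -1 <= x <= 1.
Proof. by move=> ?; apply/andP; split; nra. Qed.

(* 1100 is large enough for [mu = L eps] to meet the hypotheses of [good_move],
   given that |e - p|^2 <= 8 r^2; see [small_margin]. *)
Lemma search_succeeds (r rt eps : K) (b N L : nat) (p e pt et : 'rV[K]_2) :
  0 < r -> r + 2 <= b%:R -> (8 <= N)%N -> 4 * r ^+ 2 <= N%:R -> (0 < L)%N ->
  lipschitz_on K b L (dist_exp :: slack_exps N) ->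
  disk r p -> disk r e -> enorm (p - pt) <= eps -> enorm (e - et) <= eps ->
  `|r - rt| <= eps -> 0 < eps <= 1 ->
  0 < reval (point pt et 0 rt 0 eps) (margin (1100 * L * b ^ 2 + L) dist_exp) ->
  exists s1 s2 a1 a2 c n : nat,
    all (fun i => i <= n)%N [:: s1; s2; a1; a2; c] /\
    all (fun g => 0 < reval (point pt et (map_mx ratr (cvec s1 a1 s2 a2 n)) rt
                               (ratr (candq 0 c n)) eps) (margin L g))
        (slack_exps N).
Proof.
move=> r0 rb N8 rN L0 lip pD eD pp ee rr /andP[eps0 eps1].
have b2 : 2 <= b%:R :> K by lra.
have b1 : 1 <= b%:R :> K by lra.
have rb' : `|r| <= b%:R by rewrite gtr0_norm //; lra.
have rtb : `|rt| <= b%:R.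
  have := ler_normD r (rt - r); rewrite addrC subrK distrC.
  by rewrite (gtr0_norm r0); lra.
have epsb : eps <= b%:R by lra.
have epsb' : `|eps| <= b%:R by rewrite gtr0_norm.
have [pb ptb] := approx_bounded r0 rb pD pp eps1.
have [eb etb] := approx_bounded r0 rb eD ee eps1.
set mu := L%:R * eps.
have mu0 : 0 < mu by rewrite mulr_gt0 ?ltr0n.
move=> sep.
have [mu48 mur mur2 muD] : [/\ 48 * mu <= 1, 28 * mu < r, 40 * mu <= r ^+ 2 &
    (96 * r + 5) * mu < (e 0 0 - p 0 0) ^+ 2 + (e 0 1 - p 0 1) ^+ 2].
  apply: (small_margin r0 rb mu0 _ (dist_disk_le pD eD)).
  have -> : 1100 * b%:R ^+ 2 * mu = (1100 * L * b ^ 2)%:R * eps.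
    by rewrite !natrM ?natrX /mu; ring.
  apply: (@dist_margin r rt eps b%:R L) pp ee rr sep => //; last exact: ltW.
  by move=> x y xb yb xy; exact: (lip 0%N x y eps (ltW eps0) xb yb xy).
move: (pD) (eD); rewrite /disk /= !enorm2_le ?(ltW r0) // => pD' eD'.
have [v1 [v2 [d [vv /andP[d0 d1] sl]]]] :=
  good_move N8 rN r0 pD' eD' mu0 mu48 mur mur2 muD.
have v11 : -1 <= v1 <= 1.
  by apply: sqr_le1; apply: le_trans vv; rewrite lerDl sqr_ge0.
have v21 : -1 <= v2 <= 1.
  by apply: sqr_le1; apply: le_trans vv; rewrite lerDr sqr_ge0.
have d11 : -1 <= d <= 1 by rewrite d1 (le_trans _ d0) // lerN10.
have [n1 H1] := candq_near v11 eps0.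
have [n2 H2] := candq_near v21 eps0.
have [n3 H3] := candq_near d11 eps0.
(* The [1] leaves room for the sign digits, which are also bounded by [n]. *)
pose n := (n1 + n2 + n3 + 1)%N.
have [|a1 a1n [c1 l1]] := H1 n; first by rewrite /n; clear; lia.
have [|a2 a2n [c2 l2]] := H2 n; first by rewrite /n; clear; lia.
have [|c cn [c3 l3]] := H3 n; first by rewrite /n; clear; lia.
have dF : (d < 0)%R = false by rewrite ltNge d0.
rewrite dF in c3 l3.
exists (v1 < 0)%R, (v2 < 0)%R, a1, a2, c, n; split.
  have nb (c' : bool) : (c' <= n)%N by exact: leq_trans (leq_b1 _) (leq_addl _ _).
  by rewrite /= a1n a2n cn !nb.
set vt : 'rV[K]_2 := map_mx _ _.
pose v : 'rV[K]_2 := \row_j (if j == 0 then v1 else v2).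
have vt0 : vt 0 0 = ratr (candq (v1 < 0)%R a1 n) by rewrite !mxE.
have vt1 : vt 0 1 = ratr (candq (v2 < 0)%R a2 n) by rewrite !mxE.
have v0E : v 0 0 = v1 by rewrite mxE.
have v1E : v 0 1 = v2 by rewrite mxE.
have lip' : lipschitz_on K b L (slack_exps N) by move=> i; apply: (lip i.+1).
apply: (margin_complete (x := point p e v r d eps) lip').
- apply: point_bounded; rewrite ?v0E ?v1E //; apply: (le_trans _ b1);
    by rewrite ler_norml.
- apply: point_bounded => //; rewrite ?vt0 ?vt1; exact: le_trans b1.
- by move=> i; apply: point_near; rewrite // ?v0E ?v1E ?vt0 ?vt1.
rewrite -(all_map (reval _) (fun x => 2 * (L%:R * eps) < x)) slack_expsE.
by rewrite /point [nth _ _ 0]/= [nth _ _ 1]/= [nth _ _ 2]/= [nth _ _ 3]/= /= v0E v1E.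
Qed.

End Tests.

(** * The machine *)

Section Machine.
Variables (Mr : otm void) (N L C : nat).

Local Notation T := ('I_29 + otm_tapes Mr)%type.
Local Notation "# i" := (inl (@Ordinal 29 i isT) : T) (at level 1, format "# i").

(* Tape 0 is the input, 1 the query tape, which also holds the precision,
   2 the answers, 3 the output, which also serves as evaluation stack, 4 to 6
   are scratch and 7 is the flag of [search]. Tapes 8 to 22 hold the sign, the
   numerator and the denominator of the approximations of the coordinates of
   Pursuer and Evader and of the radius, 23 to 28 the current candidate. *)
Local Notation tin := #0.
Local Notation tquery := #1.
Local Notation tans := #2.
Local Notation tout := #3.

Definition sound_tapes : uniq [:: tin; tquery; tans; tout] := isT.
Definition scratch_uniq : uniq [:: tout; #4; #5; #6] := isT.

Definition regs (inp ans : word) (l : seq nat) (tau : otm_tapes Mr -> know) :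
    store T := fun x =>
  match x with
  | inl i => if i == 0%N :> nat then Word inp
             else if i == 2%N :> nat then Word ans else unary (nth 0%N l i)
  | inr y => tau y
  end.

Definition reg_val (l : seq nat) : T -> nat :=
  fun x => if x is inl i then nth 0%N l i else 0%N.

Lemma regs_upd inp ans l tau (i : 'I_29) m : (i != 0%N :> nat) -> (i != 2%N :> nat) ->
  upd (regs inp ans l tau) (inl i) (unary m) = regs inp ans (set_nth 0%N l i m) tau.
Proof.
move=> i0 i2; apply/funext => -[j|y] //; rewrite /upd /regs nth_set_nth /=.
rewrite -[inl j == inl i]/(j == i); case: eqVneq => [->|ji].
  by rewrite (negPf i0) (negPf i2) eqxx.
by rewrite val_eqE (negPf ji).
Qed.


Definition read_rat (src s n d : T) : frag T :=
  fseq (fif src (push s true) (skip T)) (fseq (pop src)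
    (fseq (take_nat src [:: n]) (take_nat src [:: d]))).

Lemma code_ratE q :
  code_rat q = (numq q < 0) :: code_nat `|numq q|%N ++ code_nat `|denq q|%N.
Proof. by rewrite /code_rat /code_nats /= cats0. Qed.

Lemma runs_read_rat O (k : store T) (src s n d : T) q w : uniq [:: src; s; n; d] ->
  k src = Word (code_rat q ++ w) -> k s = unary 0 -> k n = unary 0 -> k d = unary 0 ->
  runs tquery tans O (read_rat src s n d) k
    (upd (upd (upd (upd k s (unary (numq q < 0)%R)) n (unary `|numq q|%N))
       d (unary `|denq q|%N)) src (Word w)).
Proof.
rewrite [uniq _]/= !inE !negb_or -!andbA => /and5P[/negPf xs /negPf xn /negPf xd].
move=> /negPf sn /and3P[/negPf sd /negPf nd _] kx ks kn0 kd.
rewrite code_ratE /= -catA in kx; set sg := numq q < 0 in kx *.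
have [sx nx dx] : [/\ (s == src) = false, (n == src) = false & (d == src) = false].
  by rewrite ![_ == src]eq_sym.
have [ns ds dn] : [/\ (n == s) = false, (d == s) = false & (d == n) = false].
  by rewrite ![_ == s]eq_sym [d == n]eq_sym.
apply: (@runs_seq _ _ _ _ _ _ _ (upd k s (unary sg))).
  apply: runs_if; rewrite kx /=; case: sg {kx} => /=.
    by apply: runs_eq; [exact: runs_push|rewrite ks].
  apply: runs_eq; first exact: runs_skip.
  by move=> z; rewrite /upd; case: eqP => // ->.
apply: runs_seq; first by apply: runs_pop; rewrite /upd xs kx.
apply: runs_seq; first by apply: runs_take_nat; rewrite ?inE ?xn // /upd eqxx.
rewrite pushed1; apply: runs_eq.
  by apply: (@runs_take_nat _ _ _ _ _ _ _ `|denq q|%N w);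
    rewrite ?inE ?xd // /upd eqxx.
move=> z; rewrite pushed1 /upd !(eqxx, xs, xn, xd, sn, sd, nd, sx, nx, dx, ns, ds, dn).
case: (eqVneq z src) => // _; case: (eqVneq z d) => [_|_].
  by rewrite kd iter_kpush cats0.
by case: (eqVneq z n) => [_|//]; rewrite kn0 iter_kpush cats0.
Qed.

Lemma regs_ans inp ans ans' l tau : upd (regs inp ans l tau) tans (Word ans') =
  regs inp ans' l tau.
Proof.
apply/funext => -[j|y] //; rewrite /upd /regs.
rewrite -[_ == _]/(j == Ordinal _); case: eqVneq => [->//|].
by rewrite -val_eqE /= => /negPf->.
Qed.

Definition ctrl_free (i : 'I_29) : bool := (i != 0%N :> nat) && (i != 2%N :> nat).

Lemma runs_read_ans O inp w l tau q (i j h : 'I_29) :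
  [&& ctrl_free i, ctrl_free j, ctrl_free h & uniq [:: i; j; h]] ->
  [&& nth 0 l i == 0, nth 0 l j == 0 & nth 0 l h == 0]%N ->
  runs tquery tans O (read_rat tans (inl i) (inl j) (inl h))
    (regs inp (code_rat q ++ w) l tau)
    (regs inp w (set_nth 0 (set_nth 0 (set_nth 0 l i (numq q < 0)%R) j `|numq q|)
      h `|denq q|)%N tau).
Proof.
case/and4P => /andP[i0 i2] /andP[j0 j2] /andP[h0 h2] U /and3P[li lj lh].
apply: runs_eq.
  apply: (@runs_read_rat O _ _ _ _ _ q w) => //; rewrite /regs.
  - rewrite -[[:: inl i; _; _]]/(map inl [:: i; j; h]) cons_uniq.
    rewrite map_inj_uniq ?U ?andbT; last by move=> ? ? [].
    apply/negP => /mapP[x xin [xE]].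
    have : x != 2%N :> nat by move: xin; rewrite !inE => /or3P[]/eqP->.
    by rewrite -xE.
  - by rewrite (negPf i0) (negPf i2) (eqP li).
  - by rewrite (negPf j0) (negPf j2) (eqP lj).
  - by rewrite (negPf h0) (negPf h2) (eqP lh).
by rewrite !regs_upd // regs_ans.
Qed.


Definition triple : Type := (nat * nat * nat)%type.
Definition rat3 (q : rat) : triple := ((numq q < 0)%R : nat, `|numq q|%N, `|denq q|%N).
Definition tri0 : triple := (0, 0, 0)%N.

(** Entries 0 and 2 are placeholders, as [regs] takes these two tapes as words; [k] is the index of
    the precision and [f] the flag. *)
Definition layout (k f : nat) (x0 x1 x2 x3 x4 : triple)
    (s1 s2 a1 a2 c n : nat) : seq nat :=
  [:: 0; k; 0; 0; 0; 0; 0; f; x0.1.1; x0.1.2; x0.2; x1.1.1; x1.1.2; x1.2;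
      x2.1.1; x2.1.2; x2.2; x3.1.1; x3.1.2; x3.2; x4.1.1; x4.1.2; x4.2;
      s1; s2; a1; a2; c; n]%N.

Local Notation layout0 k f x0 x1 x2 x3 x4 :=
  (layout k f x0 x1 x2 x3 x4 0 0 0 0 0 0).

Definition read_points : frag T :=
  fseq (query T true) (fseq (read_rat tans #8 #9 #10)
  (fseq (read_rat tans #11 #12 #13) (fseq (query T false)
  (fseq (read_rat tans #14 #15 #16) (read_rat tans #17 #18 #19))))).

Definition clears (xs : seq T) (F : frag T) : frag T :=
  foldr (fun x F => fseq (drain x [::]) F) F xs.

(** [read_rat] adds to its registers, so they are emptied before the next reading. *)
Definition next_precision : frag T :=
  clears [:: #8; #9; #10; #11; #12; #13; #14; #15; #16; #17; #18; #19]
    (push #1 true).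

Definition sgn_pos (s : T) : nexp T := NSub (NCst T 1) (NReg s).
(** The double complement maps every nonzero value to 1: the sign digit of a candidate ranges up to
    the bound of the odometer. *)
Definition sgn_neg (s : T) : nexp T := NSub (NCst T 1) (sgn_pos s).

Definition data_frac (s n d : T) : frac T :=
  (NMul (sgn_pos s) (NReg n), NMul (sgn_neg s) (NReg n), NReg d).

Definition succ_n : nexp T := NAdd (NReg #28) (NCst T 1).
Definition cand_num (a : T) : nexp T := NAdd (NMul (NReg a) succ_n) (NCst T 1).
Definition cand_den : nexp T := NMul succ_n succ_n.
Definition cand_frac (s a : T) : frac T :=
  (NMul (sgn_pos s) (cand_num a), NMul (sgn_neg s) (cand_num a), cand_den).
Definition zero_frac : frac T := (NCst T 0, NCst T 0, NCst T 1).
(** The error [2^-k] is relaxed to [1 / (k + 1)], which is a fraction in the register [k]; see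
    [expr_half_le]. *)
Definition eps_frac : frac T := (NCst T 1, NCst T 0, NAdd (NReg #1) (NCst T 1)).

Definition leaf1 : nat -> frac T := nth zero_frac
  [:: data_frac #8 #9 #10; data_frac #11 #12 #13; data_frac #14 #15 #16;
      data_frac #17 #18 #19; zero_frac; zero_frac; zero_frac; zero_frac; eps_frac].

Definition leaf2 : nat -> frac T := nth zero_frac
  [:: data_frac #8 #9 #10; data_frac #11 #12 #13; data_frac #14 #15 #16;
      data_frac #17 #18 #19; data_frac #20 #21 #22; cand_frac #23 #25;
      cand_frac #24 #26; (cand_num #27, NCst T 0, cand_den); eps_frac].

Definition test1 : nexp T := rtest leaf1 [:: margin C dist_exp].
Definition test2 : nexp T := rtest leaf2 (map (margin L) (slack_exps N)).

Local Notation search := (search tout #4 #5 #6 #7).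
Local Notation compute := (compute tout #4 #5 #6).

Definition find_precision : frag T :=
  search read_points test1 next_precision.

(** The input word is built from its end, the final [false] first; scratch tape 4 restores the
    precision on tape 1. *)
Definition write_precision : frag T :=
  fseq (put (inr (otm_in Mr) : T) false)
  (fseq (drain #1 [:: #4; inr (otm_in Mr)]) (drain #4 [:: #1])).

Definition call_radius : frag T :=
  fseq write_precision
  (fseq (sub_frag 'I_29 Mr) (read_rat (inr (otm_out Mr)) #20 #21 #22)).

Definition find_move : frag T :=
  search (skip T) test2
    (tick tout #4 #5 #6 #28 [:: #23; #24; #25; #26; #27]).

(** Output goes through a stack, hence backwards: denominator, numerator, sign, and in [program] the
    delay before the coordinates of the velocity. *)
Definition emit (a : T) (sgn : frag T) : frag T :=
  fseq (compute cand_den) (fseq (compute (cand_num a)) sgn).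

Definition emit_sign (s : T) : frag T :=
  fif s (push tout true) (push tout false).

Definition program : frag T :=
  fseq find_precision (fseq call_radius (fseq find_move
  (fseq (emit #27 (push tout false)) (fseq (emit #26 (emit_sign #24))
    (emit #25 (emit_sign #23)))))).

Definition evader_otm : otm bool := frag_otm program sound_tapes.

Section Run.
Variables (O : bool -> nat -> word) (inp : word).
Local Notation runs := (runs tquery tans O).

Lemma code_vec2 (x : 'rV[rat]_2) :
  code_vec x = code_rat (x 0 0) ++ code_rat (x 0 1) ++ [::].
Proof.
rewrite /code_vec enum_ordSl enum_ordSl enum_ord0 /=.
by have -> : lift ord0 ord0 = 1 :> 'I_2 by apply/val_inj.
Qed.

Lemma runs_ask ans l tau j :
  runs (query T j) (regs inp ans l tau) (regs inp (O j (nth 0%N l 1)) l tau).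
Proof.
apply: runs_eq.
  by apply: (@runs_query _ _ _ _ _ _ (nseq (nth 0%N l 1) true)).
by move=> z; rewrite size_nseq regs_ans.
Qed.

Lemma runs_read_points ans tau k f (p e : 'rV[rat]_2) :
  O true k = code_vec p -> O false k = code_vec e ->
  exists ans', runs read_points (regs inp ans (layout0 k f tri0 tri0 tri0 tri0 tri0) tau)
    (regs inp ans' (layout0 k f (rat3 (p 0 0)) (rat3 (p 0 1)) (rat3 (e 0 0))
                    (rat3 (e 0 1)) tri0) tau).
Proof.
move=> Op Oe; eexists.
apply: runs_seq (runs_ask _ _ _ _) _; rewrite [nth _ _ _]/= Op code_vec2.
apply: runs_seq; first exact: runs_read_ans.
apply: runs_seq; first exact: runs_read_ans.
apply: runs_seq (runs_ask _ _ _ _) _; rewrite [nth _ _ _]/= Oe code_vec2.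
apply: runs_seq; first exact: runs_read_ans.
exact: runs_read_ans.
Qed.

Lemma runs_clear ans l tau (i : 'I_29) : ctrl_free i ->
  runs (drain (inl i : T) [::]) (regs inp ans l tau)
    (regs inp ans (set_nth 0%N l i 0%N) tau).
Proof.
move=> /andP[i0 i2]; rewrite -regs_upd //; apply: runs_eq.
  apply: (@runs_drain _ _ _ _ _ _ _ (nth 0%N l i) [::]) => //.
  by rewrite /regs (negPf i0) (negPf i2) cats0.
by move=> z; rewrite /upd /pushed /= muln0.
Qed.

Lemma runs_next_precision ans tau k f x0 x1 x2 x3 :
  runs next_precision (regs inp ans (layout0 k f x0 x1 x2 x3 tri0) tau)
    (regs inp ans (layout0 k.+1 f tri0 tri0 tri0 tri0 tri0) tau).
Proof.
rewrite /next_precision /=.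
do 12 (apply: runs_seq; first exact: runs_clear).
apply: runs_eq; first exact: runs_push.
by move=> z; rewrite -[kpush _ _]/(unary k.+1) regs_upd.
Qed.


Lemma idle_regs ans k f x0 x1 x2 x3 x4 s1 s2 a1 a2 c n tau :
  idle tout #4 #5 #6 (regs inp ans (layout k f x0 x1 x2 x3 x4 s1 s2 a1 a2 c n) tau).
Proof. by []. Qed.

Lemma nreads_test1 ans l tau es :
  nreads tout #4 #5 #6 (reg_val l) (regs inp ans l tau) (rtest leaf1 es).
Proof.
apply: nreads_rtest => i; rewrite /leaf1.
by do 9?[case: i => [|i]]; rewrite /= ?nth_nil; do ![split].
Qed.

Lemma nreads_test2 ans l tau es :
  nreads tout #4 #5 #6 (reg_val l) (regs inp ans l tau) (rtest leaf2 es).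
Proof.
apply: nreads_rtest => i; rewrite /leaf2.
by do 9?[case: i => [|i]]; rewrite /= ?nth_nil; do ![split].
Qed.

Definition env1 (p e : 'rV[rat]_2) (j : nat) : T -> nat :=
  reg_val (layout0 j 1 (rat3 (p 0 0)) (rat3 (p 0 1)) (rat3 (e 0 0)) (rat3 (e 0 1)) tri0).

Lemma runs_find_precision (phi psi : nat -> 'rV[rat]_2) ans tau m :
  (forall j, O true j = code_vec (phi j)) ->
  (forall j, O false j = code_vec (psi j)) ->
  (0 < neval (env1 (phi m) (psi m) m) test1)%N ->
  (forall j, (j < m)%N -> neval (env1 (phi j) (psi j) j) test1 = 0%N) ->
  exists ans', runs find_precision
    (regs inp ans (layout0 0 0 tri0 tri0 tri0 tri0 tri0) tau)
    (regs inp ans' (layout0 m 0 (rat3 (phi m 0 0)) (rat3 (phi m 0 1))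
      (rat3 (psi m 0 0)) (rat3 (psi m 0 1)) tri0) tau).
Proof.
move=> Otrue Ofalse mpos mmin.
pose Inv j k := exists ans',
  k = regs inp ans' (layout0 j 1 tri0 tri0 tri0 tri0 tri0) tau.
pose Mid j k := exists ans', k = regs inp ans' (layout0 j 1 (rat3 (phi j 0 0))
  (rat3 (phi j 0 1)) (rat3 (psi j 0 0)) (rat3 (psi j 0 1)) tri0) tau.
have [||||k' [ans' ->] Hk'] := @runs_search _ _ _ _ _ scratch_uniq tquery tans O #7
  read_points test1 next_precision (fun j => env1 (phi j) (psi j) j) Inv Mid
  (regs inp ans (layout0 0 0 tri0 tri0 tri0 tri0 tri0) tau) m erefl _ _ _ _ mpos mmin.
- by exists ans; rewrite regs_upd.
- move=> j _ [a ->]; split=> //.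
  have [a' H] := runs_read_points a tau 1 (Otrue j) (Ofalse j).
  by eexists; [exact: H|exists a'].
- by move=> j _ [a ->]; split; [|exact: idle_regs|exact: nreads_test1].
- move=> j _ [a ->]; eexists; first exact: runs_next_precision.
  by exists a.
by exists ans'; apply: runs_eq Hk' _ => z; rewrite regs_upd.
Qed.

Definition blank_store : otm_tapes Mr -> know := fun _ => Exact blank_tape.

Lemma iter_kpush_exact k w :
  iter k (kpush true) (Exact (word_tape (false :: w))) =
  Exact (word_tape (nseq k true ++ false :: w)).
Proof. by elim: k => //= k ->; case: k. Qed.

Lemma regs_inr ans l tau y a :
  upd (regs inp ans l tau) (inr y) a = regs inp ans l (upd tau y a).
Proof. by apply/funext => -[]. Qed.

Lemma code_vec1 (x : 'rV[rat]_1) : code_vec x = code_rat (x 0 0) ++ [::].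
Proof. by rewrite /code_vec enum_ordSl enum_ord0. Qed.

Lemma runs_write_precision ans tau k x0 x1 x2 x3 :
  tau (otm_in Mr) = Exact blank_tape ->
  let s := regs inp ans (layout0 k 0 x0 x1 x2 x3 tri0) in
  runs write_precision (s tau)
    (s (upd tau (otm_in Mr) (Exact (word_tape (code_nats [:: k]))))).
Proof.
move=> tin0 s; apply: runs_seq; first by apply: runs_put_exact; exact: tin0.
rewrite /s regs_inr -[tape_write _ _]/(word_tape (false :: [::])).
set tau1 := upd tau _ _; set tau2 := upd tau _ _.
have t1in : tau1 (otm_in Mr) = Exact (word_tape (false :: [::])) by rewrite /tau1 /upd eqxx.
pose l1 := layout 0 0 x0 x1 x2 x3 tri0 0 0 0 0 0 0.
apply: (@runs_seq _ _ _ _ _ _ _ (regs inp ans (set_nth 0%N l1 4 k) tau2)).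
  apply: runs_eq.
    by apply: (@runs_drain _ _ _ _ _ _ _ k [::]); rewrite // cats0.
  rewrite pushed2 // [X in upd _ (inr _) X]/= t1in iter_kpush_exact.
  rewrite [X in upd _ #4 X](_ : _ = unary k); last by rewrite iter_kpush cats0.
  rewrite -[Word [::]]/(unary 0) regs_upd // regs_inr regs_upd // => z; congr regs.
  apply/funext => y; rewrite /tau2 /tau1 /upd; case: eqP => // _.
  by rewrite /code_nats /= cats0 /code_nat -cats1.
apply: runs_eq.
  by apply: (@runs_drain _ _ _ _ _ _ _ k [::]); rewrite // cats0.
rewrite pushed1 [X in upd _ #1 X](_ : _ = unary k); last by rewrite iter_kpush cats0.
by rewrite -[Word [::]]/(unary 0) !regs_upd.
Qed.

Lemma runs_call_radius ans k x0 x1 x2 x3 (q : 'rV[rat]_1) :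
  otm_outputs Mr no_oracle (code_nats [:: k]) (code_vec q) ->
  exists tau', runs call_radius
    (regs inp ans (layout0 k 0 x0 x1 x2 x3 tri0) blank_store)
    (regs inp ans (layout0 k 0 x0 x1 x2 x3 (rat3 (q 0 0))) tau').
Proof.
move=> Hout; set l := layout0 k 0 x0 x1 x2 x3 tri0.
have Hw := @runs_write_precision ans blank_store k x0 x1 x2 x3 erefl.
set tau1 := upd _ _ _ in Hw.
have [y|k' Hk' [kl kout]] := @sub_frag_runs 'I_29 Mr tquery tans O
  (regs inp ans l tau1) _ _ Hout.
  by rewrite /= /tau1 /upd /=; case: eqP.
have kE : k' = regs inp ans l (fun y => k' (inr y)).
  by apply/funext => -[i|y] //; rewrite kl.
rewrite code_vec1 in kout.
have Hr := @runs_read_rat O k' (inr (otm_out Mr)) #20 #21 #22 (q 0 0) [::] isT kout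
  (kl _) (kl _) (kl _).
exists (upd (fun y => k' (inr y)) (otm_out Mr) (Word [::])).
apply: runs_seq Hw _; apply: runs_seq Hk' _; apply: runs_eq Hr _ => z.
by rewrite kE !regs_upd // regs_inr.
Qed.

Definition digits : seq T := [:: #23; #24; #25; #26; #27].

Lemma overlay_regs ans k f x0 x1 x2 x3 x4 tau (v : T -> nat) :
  overlay (regs inp ans (layout0 k f x0 x1 x2 x3 x4) tau) (#28 :: digits) v =
  regs inp ans (layout k f x0 x1 x2 x3 x4 (v #23) (v #24) (v #25) (v #26) (v #27)
    (v #28)) tau.
Proof.
apply/funext => -[i|y] //; rewrite /overlay; case: ifP; last first.
  case: i => i hi; do 23?[case: i hi => [|i] hi] => // H; exfalso.
  by case: i hi H => [|[|[|[|[|[|i]]]]]] hi //=; rewrite ?inE.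
by rewrite !inE => /or4P[/eqP->|/eqP->|/eqP->|/or3P[/eqP->|/eqP->|/eqP->]].
Qed.

Definition odometer (j : nat) : T -> nat := iter j (tickv #28 digits) (fun=> 0%N).

Definition env2 (p e : 'rV[rat]_2) (q : rat) (k : nat) (v : T -> nat) : T -> nat :=
  reg_val (layout k 1 (rat3 (p 0 0)) (rat3 (p 0 1)) (rat3 (e 0 0)) (rat3 (e 0 1))
    (rat3 q) (v #23) (v #24) (v #25) (v #26) (v #27) (v #28)).

Lemma runs_find_move ans tau (p e : 'rV[rat]_2) (q : rat) (k m : nat) :
  (0 < neval (env2 p e q k (odometer m)) test2)%N ->
  (forall j, (j < m)%N -> neval (env2 p e q k (odometer j)) test2 = 0%N) ->
  runs find_move
    (regs inp ans (layout0 k 0 (rat3 (p 0 0)) (rat3 (p 0 1)) (rat3 (e 0 0))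
      (rat3 (e 0 1)) (rat3 q)) tau)
    (regs inp ans (layout k 0 (rat3 (p 0 0)) (rat3 (p 0 1)) (rat3 (e 0 0))
      (rat3 (e 0 1)) (rat3 q) (odometer m #23) (odometer m #24) (odometer m #25) (odometer m #26)
      (odometer m #27) (odometer m #28)) tau).
Proof.
move=> mpos mmin.
pose s0 := regs inp ans (layout0 k 1 (rat3 (p 0 0)) (rat3 (p 0 1)) (rat3 (e 0 0))
      (rat3 (e 0 1)) (rat3 q)) tau.
pose Inv j k' := k' = overlay s0 (#28 :: digits) (odometer j).
have [||||k' -> Hk'] := @runs_search _ _ _ _ _ scratch_uniq tquery tans O #7
  (skip T) test2 (tick tout #4 #5 #6 #28 digits) (fun j => env2 p e q k (odometer j))
  Inv Inv (regs inp ans (layout0 k 0 (rat3 (p 0 0)) (rat3 (p 0 1)) (rat3 (e 0 0))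
      (rat3 (e 0 1)) (rat3 q)) tau) m erefl _ _ _ _ mpos mmin.
- by rewrite /Inv overlay_regs regs_upd.
- move=> j k1 ->; split=> //; exists (overlay s0 (#28 :: digits) (odometer j)) => //.
  exact: runs_skip.
- move=> j _ ->; rewrite overlay_regs.
  by split; [|exact: idle_regs|exact: nreads_test2].
- move=> j _ ->; exists (overlay s0 (#28 :: digits) (odometer j.+1)) => //.
  by apply: (@runs_tick _ _ _ _ _ scratch_uniq) => //; apply/allP.
by apply: runs_eq Hk' _ => z; rewrite overlay_regs regs_upd.
Qed.

Lemma runs_emit ans l tau w w' (a : T) (sgn : frag T) (b : bool) :
  let s := regs inp ans l tau in
  nreads tout #4 #5 #6 (reg_val l) s (cand_num a) ->
  nreads tout #4 #5 #6 (reg_val l) s cand_den ->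
  [/\ nth 0%N l 4 = 0%N, nth 0%N l 5 = 0%N & nth 0%N l 6 = 0%N] ->
  w' = b :: code_nat (neval (reg_val l) (cand_num a)) ++
       code_nat (neval (reg_val l) cand_den) ++ w ->
  (forall v, runs sgn (upd s tout (Word v)) (upd s tout (Word (b :: v)))) ->
  runs (emit a sgn) (upd s tout (Word w)) (upd s tout (Word w')).
Proof.
move=> s na nd [l4 l5 l6] -> Hs.
have updK v v' : upd (upd s tout (Word v)) tout (Word v') = upd s tout (Word v').
  by apply/funext => z; rewrite /upd; case: eqP.
apply: runs_seq.
  apply: (runs_compute scratch_uniq) (nreads_upd _ nd) _ _ _ _ => //.
  - by rewrite /upd /= l4.
  - by rewrite /upd /= l5.
  - by rewrite /upd /= l6.
rewrite updK; apply: runs_seq.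
  apply: (runs_compute scratch_uniq) (nreads_upd _ na) _ _ _ _ => //.
  - by rewrite /upd /= l4.
  - by rewrite /upd /= l5.
  - by rewrite /upd /= l6.
by rewrite updK; exact: Hs.
Qed.

Lemma runs_emit_sign (s : store T) (i : T) n v : i != tout -> s i = unary n ->
  runs (emit_sign i) (upd s tout (Word v)) (upd s tout (Word ((n != 0%N) :: v))).
Proof.
move=> it si; apply: runs_if.
have -> : khead (upd s tout (Word v) i) == Some true = (n != 0%N).
  by rewrite /upd (negPf it) si; case: n {si}.
have updK v' : upd (upd s tout (Word v)) tout v' = upd s tout v'.
  by apply/funext => z; rewrite /upd; case: eqP.
by case: ifP => _; apply: runs_eq; [exact: runs_push|rewrite updK|
  exact: runs_push|rewrite updK].
Qed.


Definition move_rat (v : T -> nat) : 'rV[rat]_(2 + 1) :=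
  row_mx (cvec (v #23) (v #25) (v #24) (v #26) (v #28))
         (const_mx (candq 0 (v #27) (v #28))).

Lemma code_move_rat v : code_vec (move_rat v) =
  code_rat (candq (v #23) (v #25) (v #28)) ++
  code_rat (candq (v #24) (v #26) (v #28)) ++
  code_rat (candq 0 (v #27) (v #28)) ++ [::].
Proof.
rewrite /code_vec (_ : enum 'I_(2 + 1) = [:: lshift 1 0; lshift 1 1; rshift 2 0]).
  by rewrite /= /move_rat !row_mxEl row_mxEr !mxE.
by apply/(inj_map val_inj); rewrite val_enum_ord.
Qed.

Lemma program_outputs (phi psi : nat -> 'rV[rat]_2) (rho : nat -> 'rV[rat]_1) m1 m2 :
  (forall j, O true j = code_vec (phi j)) ->
  (forall j, O false j = code_vec (psi j)) ->
  (forall j, otm_outputs Mr no_oracle (code_nats [:: j]) (code_vec (rho j))) ->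
  (0 < neval (env1 (phi m1) (psi m1) m1) test1)%N ->
  (forall j, (j < m1)%N -> neval (env1 (phi j) (psi j) j) test1 = 0%N) ->
  (0 < neval (env2 (phi m1) (psi m1) (rho m1 0%R 0%R) m1 (odometer m2)) test2)%N ->
  (forall j, (j < m2)%N ->
     neval (env2 (phi m1) (psi m1) (rho m1 0%R 0%R) m1 (odometer j)) test2 = 0%N) ->
  otm_outputs evader_otm O inp (code_vec (move_rat (odometer m2))).
Proof.
move=> Otrue Ofalse Rout pos1 min1 pos2 min2.
have [ans1 H1] := runs_find_precision [::] blank_store Otrue Ofalse pos1 min1.
have [tau2 H2] := runs_call_radius ans1 (rat3 (phi m1 0 0)) (rat3 (phi m1 0 1))
  (rat3 (psi m1 0 0)) (rat3 (psi m1 0 1)) (Rout m1).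
have H3 := runs_find_move ans1 tau2 pos2 min2.
set l := layout _ _ _ _ _ _ _ (odometer m2 #23) _ _ _ _ _ in H3.
set s := regs inp ans1 l tau2 in H3.
have s0 : s = upd s tout (Word [::]).
  by apply/funext => z; rewrite /upd; case: eqP => // ->.
set v := odometer m2 in l s s0 H3 *.
pose w1 := code_rat (candq 0 (v #27) (v #28)) ++ [::].
pose w2 := code_rat (candq (v #24) (v #26) (v #28)) ++ w1.
have num (a : T) : neval (reg_val l) (cand_num a) = (reg_val l a * (v #28).+1 + 1)%N.
  by rewrite /= !addn1.
have den : neval (reg_val l) cand_den = ((v #28).+1 * (v #28).+1)%N.
  by rewrite /= !addn1.
have E1 : runs (emit #27 (push tout false)) s (upd s tout (Word w1)).
  rewrite {1}s0; apply: (@runs_emit ans1 l tau2 _ _ _ _ false) => //.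
    by rewrite num den /w1 code_candq cat_cons -catA.
  move=> u; apply: runs_eq; first exact: runs_push.
  by move=> z; rewrite /upd; case: eqP; rewrite ?eqxx.
have E2 : runs (emit #26 (emit_sign #24)) (upd s tout (Word w1))
    (upd s tout (Word w2)).
  apply: (@runs_emit ans1 l tau2 _ _ _ _ (v #24 != 0%N)) => //.
    by rewrite num den /w2 code_candq cat_cons -catA.
  by move=> u; apply: runs_emit_sign.
have E3 : runs (emit #25 (emit_sign #23)) (upd s tout (Word w2))
    (upd s tout (Word (code_vec (move_rat v)))).
  apply: (@runs_emit ans1 l tau2 _ _ _ _ (v #23 != 0%N)) => //.
    by rewrite num den code_move_rat code_candq cat_cons -catA.
  by move=> u; apply: runs_emit_sign.
apply: (runs_outputs _ (k' := upd s tout (Word (code_vec (move_rat v))))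
  (k := regs inp [::] (layout0 0 0 tri0 tri0 tri0 tri0 tri0) blank_store)).
- move=> [i|y] //=; rewrite -[layout _ _ _ _ _ _ _ _ _ _ _ _ _]/(nseq 29 0%N).
  rewrite nth_nseq if_same -[(inl i == _)]/(i == Ordinal _) -val_eqE /=.
  by case: eqP => _; [exact: word_tapeK|case: eqP].
- apply: runs_seq H1 _; apply: runs_seq H2 _; apply: runs_seq H3 _.
  by apply: runs_seq E1 _; apply: runs_seq E2 E3.
by rewrite /upd eqxx.
Qed.

End Run.

(** * Registers as real numbers *)

Section Denotation.
Variable K : realType.

Lemma data_denotes (v : T -> nat) (s n d : T) (q : rat) :
  v s = (numq q < 0)%R :> nat -> v n = `|numq q|%N -> v d = `|denq q|%N ->
  frac_denotes v (data_frac s n d) (ratr q : K).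
Proof.
move=> vs vn vd; split; first by rewrite /= vd absz_gt0 denq_neq0.
rewrite /fracval /= vs vn vd /ratr; congr (_ / _).
  have [q0|q0] := ltP (numq q) 0.
    rewrite subnn subn0 mul0n mul1n sub0r.
    by rewrite [in RHS](_ : numq q = - (absz (numq q))%:Z) ?rmorphN //; lia.
  by rewrite subn0 subnn mul1n mul0n subr0 -[in RHS](gez0_abs q0).
by rewrite -[in RHS](gez0_abs (denq_ge0 q)).
Qed.

Lemma cand_denotes (v : T -> nat) (s a : T) :
  frac_denotes v (cand_frac s a) (ratr (candq (v s) (v a) (v #28)) : K).
Proof.
split; first by rewrite /= addn1.
rewrite /fracval ratr_candq /= !addn1; case: eqVneq => [->|s0].
  by rewrite subn0 subnn mul1n mul0n subr0 mul1r.
have -> : (1 - v s = 0)%N by apply/eqP; rewrite subn_eq0 lt0n.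
by rewrite subn0 mul0n mul1n sub0r mulN1r mulNr.
Qed.

Lemma zero_denotes v : frac_denotes v zero_frac (0 : K).
Proof. by split; rewrite // /fracval /= subrr mul0r. Qed.

Lemma eps_denotes v : frac_denotes v eps_frac ((v #1).+1%:R^-1 : K).
Proof. by split; rewrite /= ?addn1 // /fracval /= addn1 subr0 mul1r. Qed.

Lemma leaf1_denotes (p e : 'rV[rat]_2) k i :
  frac_denotes (env1 p e k) (leaf1 i)
    (point (map_mx ratr p) (map_mx ratr e) 0 0 0 (k.+1%:R^-1) i : K).
Proof.
rewrite /leaf1 /point; do 9?[case: i => [|i]]; rewrite /= ?nth_nil ?mxE.
all: first [exact: data_denotes | exact: zero_denotes | exact: eps_denotes].
Qed.

Lemma leaf2_denotes (p e : 'rV[rat]_2) q k w i :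
  frac_denotes (env2 p e q k w) (leaf2 i)
    (point (map_mx ratr p) (map_mx ratr e)
      (map_mx ratr (cvec (w #23) (w #25) (w #24) (w #26) (w #28))) (ratr q)
      (ratr (candq 0 (w #27) (w #28))) (k.+1%:R^-1) i : K).
Proof.
rewrite /leaf2 /point; do 9?[case: i => [|i]]; rewrite /= ?nth_nil ?mxE.
all: try first [exact: data_denotes | exact: zero_denotes | exact: eps_denotes].
- exact: (cand_denotes (env2 p e q k w) #23 #25).
- exact: (cand_denotes (env2 p e q k w) #24 #26).
split; first by rewrite /= addn1.
by rewrite /fracval ratr_candq /= !addn1 subr0 mul1r.
Qed.

End Denotation.
End Machine.

(** * Correctness of the machine *)

(* The searches stop at the first success, so that their outcome does not
   depend on the input of the machine. *)
Lemma least_positive (f : nat -> nat) : (exists m, 0 < f m)%N ->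
  exists2 m, (0 < f m)%N & forall j, (j < m)%N -> f j = 0%N.
Proof.
move=> ex; case: (ex_minnP ex) => m fm mmin; exists m => // j jm.
by case: (posnP (f j)) => // /mmin; rewrite leqNgt jm.
Qed.

Lemma expr_half_le (K : realType) k : 2^-1 ^+ k <= k.+1%:R^-1 :> K.
Proof.
rewrite exprVn lef_pV2 ?posrE ?ltr0n ?exprn_gt0 //.
by rewrite -natrX ler_nat ltn_expl.
Qed.

Lemma inv_succ01 (K : realType) k : 0 < (k.+1%:R^-1 : K) <= 1.
Proof. by rewrite invr_gt0 ltr0n invf_le1 ?ltr0n // ler1n. Qed.

Lemma represents_near (K : realType) n (phi : nat -> 'rV[rat]_n) (z : 'rV[K]_n) k :
  represents phi z -> enorm (z - map_mx ratr (phi k)) <= k.+1%:R^-1.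
Proof. by move=> H; apply: le_trans (H k) (expr_half_le _ _). Qed.

Lemma dist_margin_complete (K : realType) (eps b : K) (L C : nat)
    (p e pt et : 'rV[K]_2) :
  (forall x y : nat -> K, (forall i, `|x i| <= b) -> (forall i, `|y i| <= b) ->
     (forall i, `|x i - y i| <= eps) ->
     `|reval x dist_exp - reval y dist_exp| <= L%:R * eps) ->
  0 <= eps -> eps <= b ->
  enorm p <= b -> enorm e <= b -> enorm pt <= b -> enorm et <= b ->
  enorm (p - pt) <= eps -> enorm (e - et) <= eps ->
  (C + L)%:R * eps < (e 0 0 - p 0 0) ^+ 2 + (e 0 1 - p 0 1) ^+ 2 ->
  0 < reval (point pt et 0 0 0 eps) (margin C dist_exp).
Proof.
move=> lip eps0 epsb pb eb ptb etb pp ee.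
have b0 : 0 <= b by exact: le_trans epsb.
have zb : `|(0 : K)| <= b by rewrite normr0.
have z0 j : `|(0 : 'rV[K]_2) 0 j| <= b by rewrite mxE normr0.
have z' j : `|(0 : 'rV[K]_2) 0 j - (0 : 'rV[K]_2) 0 j| <= eps by rewrite subrr normr0.
have z : `|(0 : K) - 0| <= eps by rewrite subrr normr0.
have eb' : `|eps| <= b by rewrite ger0_norm.
have := lip (point p e 0 0 0 eps) (point pt et 0 0 0 eps)
  (point_bounded pb eb zb (z0 0) (z0 1) zb eb')
  (point_bounded ptb etb zb (z0 0) (z0 1) zb eb')
  (point_near eps pp ee z (z' 0) (z' 1) z).
rewrite reval_margin !reval_dist ler_norml natrD /point /= => /andP[_ H] H1.
by clear -H H1; lra.
Qed.

Section Correctness.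
Variables (K : realType) (r : K) (Mr : otm void) (rho : nat -> 'rV[rat]_1).
Variables (N b L : nat).
Hypotheses (r0 : 0 < r) (N8 : (8 <= N)%N) (rN : 4 * r ^+ 2 <= N%:R)
  (rb : r + 2 <= b%:R) (L0 : (0 < L)%N)
  (lip : lipschitz_on K b L (dist_exp :: slack_exps N))
  (rho_r : represents rho (const_mx r))
  (Mr_rho : forall k, otm_outputs Mr no_oracle (code_nats [:: k]) (code_vec (rho k))).

Local Notation T := ('I_29 + otm_tapes Mr)%type.
Local Notation "# i" := (inl (@Ordinal 29 i isT) : T) (at level 1, format "# i").

(** The first summand is what [small_margin] requires; the extra [L] pays for the passage from the
    approximations to [p] and [e]. *)
Let C : nat := (1100 * L * b ^ 2 + L)%N.

Lemma two_le_bound : 2 <= b%:R :> K.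
Proof. by move: r0 rb; lra. Qed.

Lemma odometer_reach s1 s2 a1 a2 c n :
  all (fun i => i <= n)%N [:: s1; s2; a1; a2; c] ->
  exists m, [/\ odometer (Mr := Mr) m #23 = s1, odometer (Mr := Mr) m #24 = s2,
    odometer (Mr := Mr) m #25 = a1, odometer (Mr := Mr) m #26 = a2 &
    odometer (Mr := Mr) m #27 = c /\ odometer (Mr := Mr) m #28 = n].
Proof.
move=> sn; pose t (x : T) : nat :=
  if x is inl i then nth 0%N [:: s1; s2; a1; a2; c; n] (i - 23) else 0%N.
have [//|//|x|m Hm] := @ticks_reach T #28 (digits Mr) (fun=> 0%N) t.
  by rewrite !inE => /or4P[/eqP->|/eqP->|/eqP->|/orP[]/eqP->]; case/and5P: sn
    => ? ? ? ? /andP[].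
exists m; rewrite /odometer; split; last split; by rewrite Hm.
Qed.

Lemma radius_near k : `|r - ratr (rho k 0 0)| <= k.+1%:R^-1.
Proof.
have := represents_near k rho_r.
by rewrite /enorm big_ord1 !mxE sqrtr_sqr.
Qed.

Section Play.
Variables (p e : 'rV[K]_2) (phi psi : nat -> 'rV[rat]_2).
Hypotheses (pD : disk r p) (eD : disk r e) (pe : p != e).
Hypotheses (phi_p : represents phi p) (psi_e : represents psi e).

(** As [p] and [e] are distinct, [(C + L) / (m + 1)] falls below their squared distance for large
    [m]. *)
Lemma some_precision :
  exists m, (0 < neval (env1 (phi m) (psi m) m) (test1 Mr C))%N.
Proof.
set D := (e 0 0 - p 0 0) ^+ 2 + (e 0 1 - p 0 1) ^+ 2.
have D0 : 0 < D by exact: rV2_neq.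
pose m := Num.bound ((C + L)%:R / D); exists m.
rewrite /test1 (rtestP _ (leaf1_denotes Mr K (phi m) (psi m) m)) /= andbT.
have /andP[e0 e1] := inv_succ01 K m.
have [pb ptb] := approx_bounded r0 rb pD (represents_near m phi_p) e1.
have [eb etb] := approx_bounded r0 rb eD (represents_near m psi_e) e1.
apply: (dist_margin_complete (L := L) (b := b%:R) _ _ _ pb eb ptb etb
  (represents_near m phi_p) (represents_near m psi_e)).
- by move=> x y xb yb xy; have := lip 0%N (ltW e0) xb yb xy.
- exact: ltW.
- by apply: le_trans e1 _; have := two_le_bound; lra.
rewrite -/D ltr_pdivrMr ?ltr0n // mulrC -ltr_pdivrMr //.
apply: lt_trans (_ : m%:R < _); last by rewrite ltr_nat.
by rewrite archi_boundP // divr_ge0 // ltW.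
Qed.

Lemma test2P k v : (0 < neval (env2 (phi k) (psi k) (rho k 0%R 0%R) k v) (test2 Mr N L))%N =
  all (fun g => 0 < reval (point (map_mx ratr (phi k)) (map_mx ratr (psi k))
        (map_mx ratr (cvec (v #23) (v #25) (v #24) (v #26) (v #28)))
        (ratr (rho k 0 0)) (ratr (candq 0 (v #27) (v #28))) k.+1%:R^-1 : nat -> K)
        (margin L g)) (slack_exps N).
Proof.
rewrite /test2 (rtestP _ (leaf2_denotes K (phi k) (psi k) (rho k 0 0) k v)).
by rewrite all_map.
Qed.

Lemma some_move k :
  (0 < neval (env1 (phi k) (psi k) k) (test1 Mr C))%N ->
  exists m, (0 < neval (env2 (phi k) (psi k) (rho k 0%R 0%R) k (odometer m))
                   (test2 Mr N L))%N.
Proof.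
rewrite /test1 (rtestP _ (leaf1_denotes Mr K (phi k) (psi k) k)) /= andbT => H.
(* [H] has 0 in the slot of the radius; it fits by conversion, since [dist_exp] does not mention
   this slot. *)
have [s1 [s2 [a1 [a2 [c [n [sn Hall]]]]]]] := search_succeeds r0 rb N8 rN L0 lip
  pD eD (represents_near k phi_p) (represents_near k psi_e) (radius_near k)
  (inv_succ01 K k) H.
have [m [E1 E2 E3 E4 [E5 E6]]] := odometer_reach sn.
by exists m; rewrite (test2P k (odometer m)) E1 E2 E3 E4 E5 E6.
Qed.

Lemma move_sound k v i :
  (0 < neval (env2 (phi k) (psi k) (rho k 0%R 0%R) k v) (test2 Mr N L))%N ->
  evade r N i p e
    (map_mx ratr (cvec (v #23) (v #25) (v #24) (v #26) (v #28)),
     ratr (candq 0 (v #27) (v #28))).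
Proof.
rewrite test2P; set vt : 'rV[K]_2 := map_mx _ (cvec _ _ _ _ _); set d : K := ratr (candq 0 _ _).
set rt := ratr (rho _ _ _); set eps := _^-1 => H.
have d0 : 0 < d by rewrite /d ratr_candq mul1r divr_gt0 // ltr0n // addn1.
have /andP[e0 e1] := inv_succ01 K k; rewrite -/eps in e0 e1.
have b2 := two_le_bound.
have [pb ptb] := approx_bounded r0 rb pD (represents_near k phi_p) e1.
have [eb etb] := approx_bounded r0 rb eD (represents_near k psi_e) e1.
have Le : 0 <= L%:R * eps by rewrite mulr_ge0 // ltW.
(* The Lipschitz estimate presupposes a bounded candidate. The first two tests give the bound, as
   they involve only the candidate, which is exact, and the precision. *)
have [vv d1] : vt 0 0 ^+ 2 + vt 0 1 ^+ 2 <= 1 /\ d <= 1.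
  case/and3P: H => H1 H2 _.
  have {}H1 : 0 < 1 - (vt 0 0 * vt 0 0 + vt 0 1 * vt 0 1) - L%:R * eps by exact: H1.
  have {}H2 : 0 < 1 - d - L%:R * eps by exact: H2.
  by rewrite !expr2; split; lra.
have b1 : 1 <= b%:R :> K by lra.
have v0b : `|vt 0 0| <= b%:R.
  apply: le_trans b1; rewrite ler_norml; apply: sqr_le1.
  by apply: le_trans vv; rewrite lerDl sqr_ge0.
have v1b : `|vt 0 1| <= b%:R.
  apply: le_trans b1; rewrite ler_norml; apply: sqr_le1.
  by apply: le_trans vv; rewrite lerDr sqr_ge0.
have db : `|d| <= b%:R by rewrite (gtr0_norm d0) (le_trans d1).
have epsb : `|eps| <= b%:R by rewrite (gtr0_norm e0) (le_trans e1).
have rb' : `|r| <= b%:R by rewrite gtr0_norm //; move: rb; lra.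
have rr := radius_near k; rewrite -/rt -/eps in rr.
have rtb : `|rt| <= b%:R.
  have := ler_normD r (rt - r); rewrite addrC subrK distrC.
  by rewrite (gtr0_norm r0); move: rb; lra.
split=> //=.
have lip' : lipschitz_on K b L (slack_exps N) by move=> j; apply: (lip j.+1).
have := margin_sound (x := point p e vt r d eps) lip' _ _ _ H.
rewrite -![all (fun g => 0 < _) _](all_map (reval _) (fun x => 0 < x)).
rewrite !slack_expsE; apply.
- exact: point_bounded.
- exact: point_bounded.
move=> j; apply: point_near; rewrite ?subrr ?normr0 ?(ltW e0) //.
- exact: represents_near.
- exact: represents_near.
Qed.

End Play.

Lemma evade_computable : computable_strategy r (evade r N).
Proof.
exists (evader_otm Mr N L C) => i p e phi psi pD eD pe phi_p psi_e.
have [m1 pos1 min1] := least_positive (some_precision pD eD pe phi_p psi_e).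
have [m2 pos2 min2] := least_positive (some_move pD eD phi_p psi_e pos1).
have ev := move_sound pD eD phi_p psi_e i pos2.
(* The selected pair is rational, so a constant sequence represents it with error 0 at every
   accuracy. *)
eexists; exists (fun _ => move_rat (odometer (Mr := Mr) m2)); split; first exact: ev.
- move=> k; rewrite /move_rat /= map_row_mx map_const_mx subrr.
  by rewrite /enorm big1 ?sqrtr0 ?exprn_ge0 // => j _; rewrite mxE expr0n.
by move=> k; apply: (program_outputs (phi := phi) (psi := psi) _ _ _ Mr_rho pos1 min1 pos2 min2).
Qed.

End Correctness.

Theorem theorem17 (K : realType) (r : K) (r_gt0 : 0 < r)
    (r_computable : computable_real r) :
  exists F : strategy K,
    [/\ piecewise_blind r F, computable_strategy r F & winning r F].
Proof.
case: r_computable => Mr [rho [rho_r Mr_rho]].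
(* The bound on [4 r^2] keeps the delay [2 h / N] at most 1/2; the 8 meets the hypothesis [8 <= N]
   of [good_move]. *)
pose N := (Num.bound (4 * r ^+ 2) + 8)%N.
have N8 : (8 <= N)%N by rewrite leq_addl.
have rN : 4 * r ^+ 2 <= N%:R.
  rewrite natrD; apply: ler_wpDr => //.
  by rewrite ltW // archi_boundP // mulr_ge0 // sqr_ge0.
(* Room for approximations of [p], [e] and [r] with error at most 1, and for the coordinates of a
   move. *)
pose b := Num.bound (r + 2).
have rb : r + 2 <= b%:R by rewrite ltW // archi_boundP // addr_ge0 // ltW.
have [L L0 lip] := lipschitz_on_exists K b (dist_exp :: slack_exps N).
exists (evade r N); split.
- exact: evade_admissible (ltW r_gt0).
- exact: evade_computable r_gt0 N8 rN rb L0 lip rho_r Mr_rho.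
exact: evade_winning (ltW r_gt0).
Qed.
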